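(* Let $f,g$ be two non-degenerate real ternary quadratic forms generating a pencil in orbit Ia. Suppose that their zero loci are nested, that is, $([f],[g])$ is in class IaN. Then the following are necessary and sufficient conditions for $[f=0]$ to lie inside $[g=0]$: (1) when $\Phi_{03}R<0$: $\Phi_{30}B_1>0$ and $\Phi_{03}q_2<0$; (2) when $\Phi_{03}R>0$: $\Phi_{30}B_1\le0$ or $\Phi_{03}q_2\le0$; (3) when $R=0$: $\Phi_{03}q_2<0$.
   Context: For a non-zero real ternary quadratic form $f$, $[f]\in\mathbb{P}(S^2{\mathbb{R}^3}^* )$ is the associated conic and $[f=0]\subset\mathbb{RP}^2$ its zero locus. A proper (i.e. $f$ non-degenerate) non-empty conic cuts $\mathbb{RP}^2$ into two connected components, one homeomorphic to a Möbius strip (outside), the other to an open disk (inside). $[f=0]$ lies inside $[g=0]$ if it is contained in the inside of $[g=0]$. Orbit Ia is the $PGL(3,\mathbb{R})$-orbit of the pencil of conics (projective line in $\mathbb{P}(S^2{\mathbb{R}^3}^* )$) generated by $x^2+y^2+z^2$ and $xz$. The degenerate conics of a pencil cut it into arcs (the connected components of the set of its proper conics). Class IaN is the class of couples of distinct proper non-empty conics generating a pencil in orbit Ia and lying on a same arc of it; for such couples one of the conics lies inside the other. Let $\mathrm{Matrix}(q)$ be the symmetric matrix of a quadratic form $q$, and $\phi(t)=\det\mathrm{Matrix}(tf+g)=\Phi_{30}t^3+\Phi_{21}t^2+\Phi_{12}t+\Phi_{03}$. Define $\psi(t)$ by $\det(vI-\mathrm{Matrix}(tf+g))=v^3-\mu(t)v^2+\psi(t)v-\phi(t)$.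 Let $$Q=\tfrac12\,\mathrm{Remainder}(\Phi_{30}\,\phi''\phi'\psi,\ \phi)=q_2t^2+q_1t+q_0$$ (remainder in the euclidean division by $\phi$), $$B_1=\begin{vmatrix} \Phi_{30} & \Phi_{21} & \Phi_{12} \\ 0 & q_2 & q_1 \\ q_2 & q_1 & q_0 \end{vmatrix},\qquad R=\frac{\mathrm{Res}(\phi'',\phi)}{8\,\Phi_{30}},$$ with $\mathrm{Res}$ the resultant (determinant of the Sylvester matrix), so that $\mathrm{Res}(\phi'',\phi)=(6\Phi_{30})^3\,\phi\!\left(-\Phi_{21}/(3\Phi_{30})\right)$. *)

(* Defs.v *)
From HB Require Import structures.
From mathcomp Require Import all_boot all_order all_algebra generic_quotient.
From mathcomp Require Import all_classical all_reals all_analysis.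

Set Implicit Arguments.
Unset Strict Implicit.
Unset Printing Implicit Defensive.

Import Order.TTheory GRing.Theory Num.Theory.
Import numFieldNormedType.Exports.

Local Open Scope classical_set_scope.
Local Open Scope ring_scope.
Local Open Scope quotient_scope.

Definition homeomorphic (T U : topologicalType) : Prop :=
  exists (h : T -> U) (k : U -> T),
    [/\ continuous h, continuous k, cancel h k & cancel k h].

(** * Projective space of a space of matrices

    [projective R m n] is P('M[R]_(m.+1, n.+1)): non-zero matrices up to
    non-zero scalars, with the quotient topology.  RP^2 is P of the space of
    column vectors, and conics are points of P('M[R]_3) (see below). *)

Section Projective.
Context (R : realType) (m n : nat).
Local Notation V := 'M[R]_(m.+1, n.+1).

Definition nonzero : set V := [set v | v != 0].

Definition proportional (u v : nonzero) : bool :=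
  `[< exists2 c : R, c != 0 & \val v = c *: \val u >].

Lemma proportional_refl : reflexive proportional.
Proof. by move=> u; apply/asboolP; exists 1; rewrite ?oner_neq0 ?scale1r. Qed.

Lemma proportional_sym : symmetric proportional.
Proof.
have sub u v : proportional u v -> proportional v u.
  move=> /asboolP[c c0 vE]; apply/asboolP; exists c^-1; first by rewrite invr_eq0.
  by rewrite vE scalerA mulVf // scale1r.
by move=> u v; apply/idP/idP; apply: sub.
Qed.

Lemma proportional_trans : transitive proportional.
Proof.
move=> v u w /asboolP[c c0 vE] /asboolP[d d0 wE]; apply/asboolP; exists (d * c).
  by rewrite mulf_neq0.
by rewrite wE vE scalerA.
Qed.

Definition proportional_equiv : equiv_rel nonzero :=
  EquivRel proportional proportional_refl proportional_sym proportional_trans.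

Definition projective : Type :=
  quotient_topology {eq_quot proportional_equiv}.


(* A representative of a point; the sets of points defined below from [rep]
   do not depend on its choice. *)
Definition rep (p : projective) : V := \val (repr p).

Lemma const_mx1_nonzero : nonzero (const_mx 1).
Proof.
apply/negP => /eqP /matrixP /(_ 0 0); rewrite !mxE => /eqP.
by rewrite oner_eq0.
Qed.

Definition base_vector : nonzero :=
  exist (fun v => v \in nonzero) (const_mx 1) (mem_set const_mx1_nonzero).

(* The point [v]; a dummy value is used for [v = 0]. *)
Definition point_of (v : V) : projective :=
  \pi_projective (insubd base_vector v).

End Projective.

(** * Conics

    A real ternary quadratic form is encoded by its symmetric matrix
    [f : 'M[R]_3] (so that Matrix(f) is [f] itself), and its conic is the point
    of P('M[R]_3) it represents; P(S^2 R^3* ) is the subspace of P('M[R]_3) of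
    the points with symmetric representatives. *)

Notation RP2 R := (projective R 2 0).
Notation conic R := (projective R 2 2).

Section Conics.
Context (R : realType).
Implicit Types f g : 'M[R]_3.

Definition qeval f (v : 'cV[R]_3) : R := (v^T *m f *m v) 0 0.

Definition locus f : set (RP2 R) := [set p | qeval f (rep p) = 0].

Definition open_disk : set (R * R) := [set z | z.1 ^+ 2 + z.2 ^+ 2 < 1].

(* The inside of a proper non-empty conic is the one of the two components of
   its complement that is homeomorphic to an open disk. *)
Definition inside f : set (RP2 R) :=
  [set p | ~ locus f p /\
    homeomorphic (set_type (connected_component (~` locus f) p))
                 (set_type open_disk)].

Definition lies_inside f g : Prop := locus f `<=` inside g.

(** * Pencils *)

Definition proper_conic : set (conic R) := [set p | \det (rep p) != 0].

Definition pencil f g : set (conic R) :=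
  [set p | exists a b : R, rep p = a *: f + b *: g].

(* The matrix of the form xz. *)
Definition xz_form : 'M[R]_3 :=
  2^-1 *: (delta_mx 0 ord_max + delta_mx ord_max 0).

(* [P] acts on forms by composition, hence on matrices by congruence;
   [1%:M] is the matrix of x^2 + y^2 + z^2. *)
Definition orbit_Ia f g : Prop :=
  exists2 P : 'M[R]_3, P \in unitmx &
    pencil f g = pencil (P^T *m 1%:M *m P) (P^T *m xz_form *m P).

Definition same_arc f g : Prop :=
  connected_component (pencil f g `&` proper_conic) (point_of f) (point_of g).

Definition class_IaN f g : Prop :=
  [/\ point_of f <> point_of g :> conic R,
      \det f != 0 /\ locus f !=set0,
      \det g != 0 /\ locus g !=set0,
      orbit_Ia f g & same_arc f g].

(** * Invariants *)

(* The matrix of t f + g, with indeterminate t. *)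
Definition pencil_mx f g : 'M[{poly R}]_3 :=
  'X *: map_mx polyC f + map_mx polyC g.

Definition phi f g : {poly R} := \det (pencil_mx f g).

Definition Phi30 f g : R := (phi f g)`_3.
Definition Phi21 f g : R := (phi f g)`_2.
Definition Phi12 f g : R := (phi f g)`_1.
Definition Phi03 f g : R := (phi f g)`_0.

(* The coefficient of v in det(v I - Matrix(t f + g)). *)
Definition psi f g : {poly R} := (char_poly (pencil_mx f g))`_1.

Definition Qpoly f g : {poly R} :=
  2^-1 *: ((Phi30 f g *: ((phi f g)^`(2) * (phi f g)^`() * psi f g))
             %% phi f g).

Definition q2 f g : R := (Qpoly f g)`_2.
Definition q1 f g : R := (Qpoly f g)`_1.
Definition q0 f g : R := (Qpoly f g)`_0.

Definition mx3_of_rows (s : seq (seq R)) : 'M[R]_3 :=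
  \matrix_(i, j) nth 0 (nth [::] s i) j.

Definition B1 f g : R :=
  \det (mx3_of_rows [:: [:: Phi30 f g; Phi21 f g; Phi12 f g];
                        [:: 0;         q2 f g;    q1 f g];
                        [:: q2 f g;    q1 f g;    q0 f g]]).

(* The Sylvester matrix of the library lists coefficients by increasing degree,
   so that its determinant [resultant p q] is
   (-1) ^ (deg p * deg q) Res(p, q) = Res(q, p): hence the swapped arguments. *)
Definition Rinv f g : R :=
  resultant (phi f g) (phi f g)^`(2) / (8 * Phi30 f g).

End Conics.

(* Main.v *)
Require Import Defs.
From mathcomp Require Import all_boot all_order all_algebra generic_quotient.
From mathcomp Require Import all_classical all_reals all_analysis.
From mathcomp Require Import ring lra.
Import Order.TTheory GRing.Theory Num.Theory.
Import numFieldNormedType.Exports.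

(** Why the proposition holds.

    Normal form ([IaN_normal_form]).  The forms x^2 + y^2 + z^2 and xz are
    simultaneously diagonalizable, so there are coordinates in which
    f = l ((1 + s) x^2 + y^2 + (1 - s) z^2) and
    g = m ((1 + t) x^2 + y^2 + (1 - t) z^2).  Non-emptiness gives |s| > 1 and
    |t| > 1; the two conics being on a same arc, s and t have the same sign,
    because slope 1 corresponds to a degenerate conic; that sign can be made
    positive.

    Nesting ([lies_inside_diag3]).  A comparison of the two forms on [f = 0]
    shows that [f = 0] lies on the negative side of the cone of g if and only if
    s < t.  It remains to see that this side is the inside of [g = 0]
    ([insideE]).  It is a disk, by an explicit chart.  The other side is not:
    it contains a loop that lifts to an arc of vectors from v to - v, and no
    subset of the projective plane homeomorphic to a disk contains such a loop
    ([disk_no_antipodal_loop]).  Indeed the loop would contract to a point in the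
    disk, but the sign by which a vector is multiplied when it is moved along a
    loop is a continuous function of the loop ([antipodal_loop_not_contractible]).

    Algebra ([invariants_criterion]).  The polynomial phi has the three real roots
    t_i = - (m / l) r_i with r_0 = (1 + t) / (1 + s), r_1 = 1 and
    r_2 = (1 - t) / (1 - s), and psi (t_i) is, up to a positive factor, the product
    of the two factors of phi that do not vanish at t_i.  The invariants q2 and
    B1 are, up to powers of Phi30, the upper left entry and the determinant of a
    binary quadratic form \sum_i w_i (x + t_i y)^2 whose weights w_i have signs
    dictated by the position of the roots ([Q_split], [B1_split]).  Two of these
    signs tell which conic is inside; the third one, that of the middle root, is
    given by R ([Rinv_split]).  The three cases of the proposition are what the
    definiteness or indefiniteness of the form implies ([signature_criterion]). *)

Set Implicit Arguments.
Unset Strict Implicit.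
Unset Printing Implicit Defensive.
Local Open Scope classical_set_scope.
Local Open Scope ring_scope.

(** * Points of projective space *)

Section ProjectivePoints.
Context (R : realType) (m n : nat).
Local Notation V := 'M[R]_(m.+1, n.+1).
Local Notation P := (projective R m n).
Local Notation piP := (\pi_(P)%qT : @nonzero R m n -> P).

Lemma rep_neq0 (p : P) : rep p != 0.
Proof. by rewrite /rep; have /set_mem := valP (repr p). Qed.

Lemma rep_point_of (v : V) : v != 0 ->
  exists2 c : R, c != 0 & rep (point_of v) = c *: v.
Proof.
move=> v0; rewrite /rep /point_of.
set u := insubd _ _; have uE : \val u = v.
  by rewrite /u /insubd insubT //=; apply/mem_set.
have : @proportional_equiv R m n u (repr (piP u)).
  by apply/eqmodP; rewrite reprK.
by move=> /asboolP[c c0 ->]; exists c; rewrite // uE.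
Qed.

Lemma point_of_rep (p : P) : point_of (rep p) = p.
Proof.
rewrite /point_of /rep /insubd insubT; first exact: valP.
move=> H; rewrite -[RHS]reprK; congr (piP _).
exact: val_inj.
Qed.

Lemma point_ofZ (c : R) (v : V) : c != 0 -> v != 0 ->
  point_of (c *: v) = point_of v :> P.
Proof.
move=> c0 v0; have cv0 : c *: v != 0 by rewrite scaler_eq0 negb_or c0.
apply/eqmodP; apply/asboolP; exists c^-1; first by rewrite invr_eq0.
by rewrite /insubd !insubT /= ?scalerA ?mulVf ?scale1r //; apply/mem_set.
Qed.

Lemma nonzero_open : open (@nonzero R m n).
Proof.
have -> : @nonzero R m n = ~` [set 0].
  by apply/seteqP; split=> v /= /eqP.
apply/closed_openC/accessible_closed_set1.
exact/hausdorff_accessible/norm_hausdorff.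
Qed.

Lemma point_of_continuous (v : V) : v != 0 -> {for v, continuous (@point_of R m n)}.
Proof.
move=> v0 /= W; rewrite nbhsE => -[U [oU Uv] UW].
have [B oB BU] : open (piP @^-1` U) by exact: oU.
rewrite nbhs_simpl /=; apply: filterS (preimage_subset UW) _.
have ptE (w : V) (w0 : w \in @nonzero R m n) :
    point_of w = piP (exist (fun v => v \in @nonzero R m n) w w0).
  by rewrite /point_of /insubd insubT.
have memz w : w != 0 -> w \in @nonzero R m n by move=> w0; apply/mem_set.
have BE w : w != 0 -> B w <-> U (point_of w).
  move=> w0; rewrite (ptE _ (memz _ w0)).
  move: BU => /seteqP[a b].
  by split; [exact: (a (exist _ w (memz _ w0)))|exact: (b (exist _ w (memz _ w0)))].
rewrite nbhsE; exists (B `&` @nonzero R m n); first split.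
- exact: openI nonzero_open.
- by split=> //; apply/BE.
- by move=> w [Bw w0]; apply/BE.
Qed.

Lemma point_of_comp_continuous (T : topologicalType) (w : T -> V) :
  continuous w -> (forall x, w x != 0) -> continuous (fun x => point_of (w x) : P).
Proof.
move=> cw w0 x; apply: (cvg_comp w _ (cw x)); exact: point_of_continuous.
Qed.

(** The projection onto the quotient is open: the saturation of an open set
    of vectors is the union of its multiples.  Hence a function on the points
    that comes from a scale-invariant function of the vectors is continuous
    wherever the latter is. *)
Lemma rep_comp_continuous (T : topologicalType) (F : V -> T) (p : P) :
    (forall c v, c != 0 -> v != 0 -> F (c *: v) = F v) ->
    {for rep p, continuous F} ->
  {for p, continuous (F \o @rep R m n)}.
Proof.
move=> FZ Fp W /Fp; rewrite nbhs_simpl /=.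
rewrite nbhsE => -[B [oB Bp] BW].
change (nbhs p ((F \o @rep R m n) @^-1` W)); rewrite nbhsE.
(* the image in the quotient of the saturation of B *)
exists [set q : P | exists2 c : R, c != 0 & B (c *: rep q)]; last first.
  by move=> q /= [c c0 /BW /=]; rewrite FZ ?rep_neq0.
split; last by exists 1; rewrite ?oner_neq0 ?scale1r.
change (open (piP @^-1`
   [set q : P | exists2 c : R, c != 0 & B (c *: rep q)])).
exists (\bigcup_(c in [set c : R | c != 0]) ( *:%R c @^-1` B)).
  apply: bigcup_open => c _.
  have /continuousP : continuous ( *:%R c : V -> V) by exact: scaler_continuous.
  exact.
have repi (u : @nonzero R m n) : exists2 d, d != 0 & rep (piP u) = d *: \val u.
  have : @proportional_equiv R m n u (repr (piP u)).
    by apply/eqmodP; rewrite reprK.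
  by move=> /asboolP[c c0 cE]; exists c.
apply/seteqP; split=> u /=; have [d d0 ->] := repi u.
  move=> [c /= c0 Bc]; exists (c / d); first by rewrite mulf_neq0 ?invr_eq0.
  by rewrite scalerA divfK.
by move=> [c c0]; rewrite scalerA => Bc; exists (c * d) => //=; rewrite mulf_neq0.
Qed.

End ProjectivePoints.

(** * Continuity and connectedness *)

Section RealValuedContinuity.
Context (R : realType) (T : topologicalType).
Implicit Types (x : T) (f g : T -> R).

Lemma continuous_at_mul x f g : {for x, continuous f} ->
  {for x, continuous g} -> {for x, continuous (fun y => f y * g y)}.
Proof. by move=> cf cg; apply: cvgM. Qed.

Lemma continuous_at_sub x f g : {for x, continuous f} ->
  {for x, continuous g} -> {for x, continuous (fun y => f y - g y)}.
Proof. by move=> cf cg; apply: cvgB. Qed.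

Lemma continuous_at_inv x f : f x != 0 -> {for x, continuous f} ->
  {for x, continuous (fun y => (f y)^-1)}.
Proof. by move=> fx0 cf; apply: cvgV. Qed.

Lemma continuous_at_sum x (I : Type) (r : seq I) (f : I -> T -> R) :
    (forall i, {for x, continuous (f i)}) ->
  {for x, continuous (fun y => \sum_(i <- r) f i y)}.
Proof.
move=> cf; elim: r => [|i r IH]; rewrite /prop_for /continuous_at.
  by rewrite big_nil; under eq_cvg do rewrite big_nil; exact: cvg_cst.
by rewrite big_cons; under eq_cvg do rewrite big_cons; apply: cvgD => //; exact: cf.
Qed.

(** A form of the Heine theorem: a strict inequality that holds along the
    slice e = 0 of a compact set still holds for all small e, uniformly. *)
Lemma compact_near_pos (K : set T) (G : T * R -> R) :
    compact K -> continuous G -> (forall x, K x -> 0 < G (x, 0)) ->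
  \forall e \near 0, forall x, K x -> 0 < G (x, e).
Proof.
move=> /compact_near_coveringP cK cG G0.
apply: (cK R (nbhs (0 : R)) (fun e x => 0 < G (x, e))) => x Kx.
have [[A B] [nA nB] AB] := @cvgr_gt R _ _ _ G (G (x, 0)) (cG (x, 0)) _ (G0 _ Kx).
exists (A, B) => // -[y e] ABye; exact: (AB (y, e) ABye).
Qed.

Lemma connected_same_sign (B : set T) (N : T -> R) p :
  connected B -> {in B, continuous N} -> (forall q, B q -> N q != 0) -> B p ->
  N p < 0 -> forall q, B q -> N q < 0.
Proof.
move=> cB cN N0 Bp Np q Bq.
have : connected (N @` B).
  apply: connected_continuous_connected => //.
  exact: continuous_in_subspaceT.
move=> /connected_intervalP NB; rewrite ltNge; apply/negP => Nq.
have [z Bz Nz] : (N @` B) 0.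
  by apply: (NB (N p) (N q)); [exists p|exists q|rewrite (ltW Np)].
by have := N0 z Bz; rewrite Nz eqxx.
Qed.

End RealValuedContinuity.

Lemma continuous_pair (T U W : topologicalType) (f : T -> U) (g : T -> W) :
  continuous f -> continuous g -> continuous (fun x => (f x, g x)).
Proof. by move=> cf cg x; apply: cvg_pair; [exact: cf|exact: cg]. Qed.

Lemma continuous_compose (T U W : topologicalType) (f : T -> U) (g : U -> W) :
  continuous f -> continuous g -> continuous (fun x => g (f x)).
Proof. by move=> cf cg x; apply: (cvg_comp f g (cf x)); exact: cg. Qed.

Lemma continuous_set_type (T U : topologicalType) (A : set U)
    (f : T -> set_type A) :
  continuous (fun x => set_val (f x)) -> continuous f.
Proof. exact: continuous_comp_initial. Qed.

(** * Holonomy of a closed polygon in projective space *)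

Section Holonomy.
Context (R : realType) (m : nat).
Local Notation V := 'cV[R]_m.+1.
Local Notation P := (projective R m 0).

Definition dot (u v : V) : R := \sum_i u i 0 * v i 0.

Lemma dotE (u v : V) : u^T *m v = (dot u v)%:M.
Proof.
by apply/matrixP => i j; rewrite !ord1 !mxE; apply: eq_bigr => k _; rewrite mxE.
Qed.

Lemma dotC (u v : V) : dot u v = dot v u.
Proof. by apply: eq_bigr => i _; rewrite mulrC. Qed.

Lemma dot_gt0 (v : V) : v != 0 -> 0 < dot v v.
Proof.
move=> v0; have [i vi0] : exists i, v i 0 != 0.
  apply/existsP; rewrite -negb_forall; apply: contra v0 => /forallP v0.
  by apply/eqP/matrixP => i j; rewrite ord1 mxE; apply/eqP.
rewrite /dot (bigD1 i) //= ltr_pwDl //; first by rewrite -expr2 exprn_even_gt0.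
by apply: sumr_ge0 => k _; rewrite -expr2 sqr_ge0.
Qed.

Lemma dotZl c (u v : V) : dot (c *: u) v = c * dot u v.
Proof. by rewrite /dot mulr_sumr; apply: eq_bigr => i _; rewrite mxE mulrA. Qed.

Lemma dotZr c (u v : V) : dot u (c *: v) = c * dot u v.
Proof. by rewrite /dot mulr_sumr; apply: eq_bigr => i _; rewrite mxE mulrCA. Qed.

Lemma dot_continuous (T : topologicalType) (u v : T -> V) (x : T) :
  {for x, continuous u} -> {for x, continuous v} ->
  {for x, continuous (fun y => dot (u y) (v y))}.
Proof.
move=> cu cv; apply: continuous_at_sum => i; apply: continuous_at_mul.
  by apply: (cvg_comp u (fun M : V => M i 0) cu); exact: coord_continuous.
by apply: (cvg_comp v (fun M : V => M i 0) cv); exact: coord_continuous.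
Qed.

(** The orthogonal projector on the line of [v]: a representation of points by
    matrices which, unlike a choice of representatives, is continuous. *)
Definition projector (v : V) : 'M[R]_m.+1 := (dot v v)^-1 *: (v *m v^T).

Lemma projectorZ c (v : V) : c != 0 -> v != 0 ->
  projector (c *: v) = projector v.
Proof.
move=> c0 v0; apply/matrixP => i j; rewrite !mxE !big_ord1 !mxE dotZl dotZr.
have := dot_gt0 v0; move: (dot v v) => d d0; field.
by rewrite c0 gt_eqF.
Qed.

Lemma projector_continuous i j (v : V) : v != 0 ->
  {for v, continuous (fun w : V => projector w i j)}.
Proof.
move=> v0.
have -> : (fun w : V => projector w i j) =
    (fun w : V => (dot w w)^-1 * (w i 0 * w j 0)).
  by apply/funext => w; rewrite !mxE big_ord1 !mxE.
apply: continuous_at_mul; last by apply: continuous_at_mul; exact: coord_continuous.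
apply: continuous_at_inv; first by rewrite gt_eqF // dot_gt0.
by apply: dot_continuous => ?.
Qed.

Lemma projector_rep_continuous i j :
  continuous (fun p : P => projector (rep p) i j).
Proof.
move=> p; apply: (@rep_comp_continuous _ _ _ _ (fun w => projector w i j)).
  by move=> c v c0 v0; rewrite projectorZ.
exact/projector_continuous/rep_neq0.
Qed.

(** The inner factors (u i)^T *m u i.+1 of the product are scalars. *)
Lemma prod_rank_one (u : nat -> V) N :
  \prod_(0 <= i < N.+1) (u i *m (u i)^T : 'M[R]_m.+1) =
  (\prod_(0 <= i < N) dot (u i) (u i.+1)) *: (u 0%N *m (u N)^T).
Proof.
elim: N => [|N IH]; first by rewrite big_nat1 big_nil scale1r.
rewrite big_nat_recr //= IH [in RHS]big_nat_recr //= -scalerAl -scalerA.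
congr (_ *: _); rewrite -[LHS]/(_ *m _) mulmxA -(mulmxA _ _ (u N.+1)) dotE.
by rewrite mul_mx_scalar scalemxAl.
Qed.

(** Up to a positive factor, this trace is the product of the scalar products
    of consecutive representatives along the closed polygon with vertices p 0,
    ..., p N, in which every representative occurs twice.  So its sign, when it
    is defined, tells whether moving a representative along the polygon, each
    time to the representative of the next vertex that makes an acute angle
    with the current one, leads back to the initial vector or to its opposite.
    As a trace of projectors it is visibly continuous in the vertices. *)
Definition holonomy (p : nat -> P) N : R :=
  \tr (\prod_(0 <= i < N.+1) projector (rep (p i))).

Lemma holonomyE (u : nat -> V) N : (forall i, u i != 0) ->
  holonomy (fun i => point_of (u i)) N =
  dot (u 0%N) (u N) * (\prod_(0 <= i < N) dot (u i) (u i.+1))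
    / \prod_(0 <= i < N.+1) dot (u i) (u i).
Proof.
move=> u0; rewrite /holonomy.
have -> : \prod_(0 <= i < N.+1) projector (rep (point_of (u i))) =
   (\prod_(0 <= i < N.+1) dot (u i) (u i))^-1 *:
   \prod_(0 <= i < N.+1) (u i *m (u i)^T : 'M[R]_m.+1).
  elim: N.+1 => [|k IH]; first by rewrite !big_nil invr1 scale1r.
  rewrite !big_nat_recr //= IH; have [c c0 ->] := rep_point_of (u0 k).
  by rewrite projectorZ // /projector -scalerAl -scalerAr scalerA invfM.
rewrite prod_rank_one !mxtraceZ mxtrace_mulC dotE mxtrace_scalar mulr1n.
by rewrite dotC [RHS]mulrC; congr (_ * _); rewrite mulrC.
Qed.

Lemma holonomy_continuous (T : topologicalType) (p : nat -> T -> P) N :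
  (forall i, continuous (p i)) -> continuous (fun x => holonomy (fun i => p i x) N).
Proof.
move=> cp x; have cM k i j :
    {for x, continuous (fun y => (\prod_(0 <= l < k) projector (rep (p l y))) i j)}.
  elim: k i j => [|k IH] i j.
    have -> : (fun y => (\prod_(0 <= l < 0) projector (rep (p l y))) i j) =
              (fun=> (1%:M : 'M[R]_m.+1) i j) by apply/funext => y; rewrite big_nil.
    exact: cst_continuous.
  have -> : (fun y => (\prod_(0 <= l < k.+1) projector (rep (p l y))) i j) =
     (fun y => \sum_q (\prod_(0 <= l < k) projector (rep (p l y))) i q *
                 projector (rep (p k y)) q j).
    by apply/funext => y; rewrite big_nat_recr //= mxE.
  apply: continuous_at_sum => q; apply: continuous_at_mul; first exact: IH.
  apply: (cvg_comp (p k) (fun z => projector (rep z) q j)); first exact: cp.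
  exact: projector_rep_continuous.
by rewrite /holonomy; apply: continuous_at_sum => i; exact: cM.
Qed.

End Holonomy.

(** * Contractible loops do not lift to antipodal arcs *)

Section AntipodalLoop.
Context (R : realType) (m : nat).
Local Notation V := 'cV[R]_m.+1.
Local Notation P := (projective R m 0).

(** The trace of the product of the two projectors: the squared cosine of
    the angle of the two lines (see [overlapE]), zero only if they are
    orthogonal. *)
Definition overlap (p q : P) : R :=
  \sum_i \sum_j projector (rep p) i j * projector (rep q) i j.

Lemma overlapE (p q : P) :
  overlap p q = dot (rep p) (rep q) ^+ 2 /
    (dot (rep p) (rep p) * dot (rep q) (rep q)).
Proof.
rewrite /overlap; move: (rep p) (rep q) => u v.
have -> : dot u v ^+ 2 = \sum_i \sum_j (u i 0 * u j 0) * (v i 0 * v j 0).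
  rewrite expr2 mulr_suml; apply: eq_bigr => i _.
  rewrite mulr_sumr; apply: eq_bigr => j _; ring.
rewrite mulr_suml; apply: eq_bigr => i _; rewrite mulr_suml.
apply: eq_bigr => j _; rewrite /projector !mxE !big_ord1 !mxE invfM; ring.
Qed.

Lemma overlap_continuous (T : topologicalType) (p q : T -> P) :
  continuous p -> continuous q -> continuous (fun x => overlap (p x) (q x)).
Proof.
move=> cp cq x; apply: continuous_at_sum => i; apply: continuous_at_sum => j.
apply: continuous_at_mul.
  apply: (cvg_comp p (fun z => projector (rep z) i j)); first exact: cp.
  exact: projector_rep_continuous.
apply: (cvg_comp q (fun z => projector (rep z) i j)); first exact: cq.
exact: projector_rep_continuous.
Qed.

(** Subdivide the loops t |-> H (s, t) into N arcs, N so large that, for all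
    s, consecutive vertices are not orthogonal.  The holonomy of the resulting
    closed polygon is then a continuous function of s without zeros on [0, 1].
    It is positive at s = 0, where all vertices coincide, and negative at s = 1,
    where the representatives [gam] of the vertices turn progressively until
    they reach the opposite of the initial one. *)
Lemma antipodal_loop_not_contractible (H : R * R -> P) (gam : R -> V) :
    continuous H -> continuous gam -> (forall t, gam t != 0) ->
    gam 1 = - gam 0 ->
    (forall t, H (1, t) = point_of (gam t)) ->
    (forall t, H (0, t) = H (0, 0)) -> (forall s, H (s, 1) = H (s, 0)) ->
  False.
Proof.
move=> cH cg g0 g1 H1 H0 Hloop.
pose I : set R := `[0, 1]%classic.
have I01 : compact I by exact: segment_compact.
have cfst (A B : topologicalType) : continuous (fun z : A * B => z.1).
  by move=> z; exact: cvg_fst.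
have csnd (A B : topologicalType) : continuous (fun z : A * B => z.2).
  by move=> z; exact: cvg_snd.
have cadd : continuous (fun z : R * R => z.1 + z.2).
  by move=> z; apply: (@cvgD R R^o); [exact: cvg_fst|exact: cvg_snd].
have near1 : \forall e \near (0 : R), forall t, I t ->
    0 < dot (gam t) (gam (t + e)).
  apply: (compact_near_pos (G := fun z => dot (gam z.1) (gam (z.1 + z.2)))) => //.
    move=> z; apply: dot_continuous.
      exact: (continuous_compose (@cfst R R) cg).
    exact: (continuous_compose cadd cg).
  by move=> t _ /=; rewrite addr0 dot_gt0.
have near2 : \forall e \near (0 : R), forall z, (I `*` I) z ->
    0 < overlap (H z) (H (z.1, z.2 + e)).
  apply: (compact_near_pos
    (G := fun w => overlap (H w.1) (H (w.1.1, w.1.2 + w.2)))).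
  - exact: compact_setX.
  - have c1 := @cfst (R * R)%type R.
    apply: overlap_continuous.
      exact: (continuous_compose c1 cH).
    apply: (continuous_compose _ cH).
    apply: continuous_pair; first exact: (continuous_compose c1 (@cfst R R)).
    apply: (continuous_compose (f := fun w => (w.1.2, w.2)) _ cadd).
    apply: continuous_pair (@csnd _ _).
    exact: (continuous_compose c1 (@csnd R R)).
  - move=> [s t] _ /=; rewrite addr0 overlapE.
    have := dot_gt0 (rep_neq0 (H (s, t))) => d0.
    by rewrite divr_gt0 ?exprn_gt0 ?mulr_gt0.
have [n [loc1 loc2]] : exists n, (forall t, I t ->
    0 < dot (gam t) (gam (t + n.+1%:R^-1))) /\
    (forall z, (I `*` I) z ->
    0 < overlap (H z) (H (z.1, z.2 + n.+1%:R^-1))).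
  have [k _ /(_ k (leqnn k)) [a b]] := (@cvg_harmonic R _ (filterI near1 near2)).
  by exists k.
(* th s is the holonomy of the loop H (s, _) at the vertices i / (n + 1) *)
pose t i : R := i%:R * n.+1%:R^-1.
have t01 i : (i <= n.+1)%N -> I (t i).
  move=> iN; rewrite /I /= in_itv /= mulr_ge0 ?invr_ge0 ?ler0n //=.
  by rewrite ler_pdivrMr ?ltr0n // mul1r ler_nat.
have tS i : t i.+1 = t i + n.+1%:R^-1 by rewrite /t -natr1 mulrDl mul1r.
have tN : t n.+1 = 1 by rewrite /t mulfV // pnatr_eq0.
have t0 : t 0%N = 0 by rewrite /t mul0r.
pose th s := holonomy (fun i => H (s, t i)) n.+1.
have th1 : th 1 < 0.
  rewrite /th (_ : (fun i => H (1, t i)) =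
    fun i => point_of (gam (t i))); last first.
    by apply/funext => i; rewrite H1.
  rewrite holonomyE // tN g1 t0 pmulr_llt0; last first.
    by rewrite invr_gt0 prodr_gt0 // => i _; rewrite dot_gt0.
  rewrite -scaleN1r dotZr mulN1r pmulr_llt0 ?oppr_lt0 ?dot_gt0 //.
  rewrite big_nat; apply: prodr_gt0 => i /andP[_ iN]; rewrite tS loc1 //.
  exact/t01/ltnW.
have th0 : 0 < th 0.
  rewrite /th (_ : (fun i => H (0, t i)) =
    fun i => point_of (rep (H (0, 0)))); last first.
    by apply/funext => i; rewrite H0 point_of_rep.
  rewrite (holonomyE (u := fun=> rep (H (0, 0)))) => [|_]; last exact: rep_neq0.
  by rewrite divr_gt0 ?mulr_gt0 ?prodr_gt0 ?dot_gt0 ?rep_neq0 // => i _;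
    rewrite dot_gt0 ?rep_neq0.
have ths s : I s -> th s != 0.
  move=> s01; pose u i := rep (H (s, t i)).
  have u0 i : u i != 0 by exact: rep_neq0.
  rewrite /th (_ : (fun i => H (s, t i)) = fun i => point_of (u i)); last first.
    by apply/funext => i; rewrite point_of_rep.
  have uN : u n.+1 = u 0%N by rewrite /u tN t0 Hloop.
  rewrite holonomyE // uN; apply: mulf_neq0; last first.
    by rewrite invr_eq0 gt_eqF // prodr_gt0 // => i _; rewrite dot_gt0.
  apply: mulf_neq0; first by rewrite gt_eqF // dot_gt0.
  rewrite prodf_seq_neq0; apply/allP => i /=; rewrite mem_index_iota => iN.
  have := loc2 (s, t i) (conj s01 (t01 _ (ltnW iN))).
  rewrite /= -tS overlapE; apply: contraTneq => ->.
  by rewrite expr0n mul0r ltxx.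
have cth : continuous th.
  apply: holonomy_continuous => i s.
  apply: (continuous_compose (f := fun s => (s, t i)) _ cH).
  by apply: continuous_pair => z; [exact: cvg_id|exact: cvg_cst].
have [c c01 thc] : exists2 c, c \in `[0, 1] & th c = 0.
  apply: IVT => //; first exact: continuous_subspaceT.
  by rewrite ge_min le_max (ltW th1) (ltW th0) orbT.
by have := ths c c01; rewrite thc eqxx.
Qed.
End AntipodalLoop.

Section ContractibleDisk.
Context (R : realType) (m : nat).
Local Notation V := 'cV[R]_m.+1.
Local Notation P := (projective R m 0).

(** In a disk every loop contracts to the centre along the radii. *)
Lemma disk_no_antipodal_loop (C : set P) (gam : R -> V) :
    homeomorphic (set_type C) (set_type (@open_disk R)) ->
    continuous gam -> (forall t, gam t != 0) -> gam 1 = - gam 0 ->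
    (forall t, C (point_of (gam t))) ->
  False.
Proof.
move=> [h [k [ch ck hK kK]]] cg g0 g1 gC.
have cval (U : topologicalType) (A : set U) : continuous (set_val : set_type A -> U).
  exact: initial_continuous.
pose pt t : set_type C := exist _ (point_of (gam t)) (mem_set (gC t)).
have cpt : continuous pt.
  by apply: continuous_set_type; exact: (point_of_comp_continuous cg g0).
pose l t : R * R := set_val (h (pt t)).
have cl : continuous l.
  apply: (continuous_compose (f := fun t => h (pt t)) _ (@cval _ _)).
  exact: continuous_compose cpt ch.
have lD t : open_disk (l t) by exact/set_mem/(valP (h (pt t))).
have pt1 : pt 1 = pt 0.
  by apply: val_inj; rewrite /= g1 -scaleN1r point_ofZ ?oppr_eq0 ?oner_eq0.
(* a parametrization of [0, 1] by the whole line: it sends 0 to 0, 1 to 1 and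
   stays in [-1, 1] everywhere, so that the contraction is total *)
pose c (s : R) : R := 2 * s / (1 + s ^+ 2).
have s1 (s : R) : 0 < 1 + s ^+ 2 by rewrite ltr_pwDl // sqr_ge0.
have c1 : c 1 = 1 by rewrite /c expr1n mulr1 divff // (@pnatr_eq0 R 2).
have c0 : c 0 = 0 by rewrite /c mulr0 mul0r.
have c_le1 s : c s ^+ 2 <= 1.
  rewrite /c exprMn exprVn ler_pdivrMr ?exprn_gt0 // mul1r -subr_ge0.
  rewrite (_ : _ - _ = (1 - s ^+ 2) ^+ 2) ?sqr_ge0 //; ring.
have cc : continuous c.
  move=> s; apply: continuous_at_mul.
    by apply: continuous_at_mul; [exact: cst_continuous|exact: cvg_id].
  apply: continuous_at_inv; first by rewrite gt_eqF.
  apply: (@cvgD R R^o); first exact: cvg_cst.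
  exact: exprn_continuous.
pose q (z : R * R) : R * R := (c z.1 * (l z.2).1, c z.1 * (l z.2).2).
have qD z : open_disk (q z).
  have := lD z.2; have := c_le1 z.1; rewrite /open_disk /q.
  move: (c z.1) (l z.2) => a [x y] /= a1 xy1; rewrite !exprMn -mulrDr.
  apply: le_lt_trans xy1; rewrite -[leRHS]mul1r ler_wpM2r //.
  by rewrite addr_ge0 ?sqr_ge0.
pose qd z : set_type (@open_disk R) := exist _ (q z) (mem_set (qD z)).
have cqd : continuous qd.
  have cfst (A B : topologicalType) : continuous (fun z : A * B => z.1).
    by move=> z; exact: cvg_fst.
  have csnd (A B : topologicalType) : continuous (fun z : A * B => z.2).
    by move=> z; exact: cvg_snd.
  apply: continuous_set_type.
  have l2 := continuous_compose (@csnd R R) cl.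
  have cz := continuous_compose (@cfst R R) cc.
  have q1 : continuous (fun z : R * R => c z.1 * (l z.2).1).
    move=> z; apply: (@continuous_at_mul R _ z
      (fun z => c z.1) (fun z => (l z.2).1)).
      exact: cz.
    exact: (continuous_compose l2 (@cfst R R)).
  have q2 : continuous (fun z : R * R => c z.1 * (l z.2).2).
    move=> z; apply: (@continuous_at_mul R _ z
      (fun z => c z.1) (fun z => (l z.2).2)).
      exact: cz.
    exact: (continuous_compose l2 (@csnd R R)).
  exact: continuous_pair q1 q2.
pose H z : P := set_val (k (qd z)).
apply: (@antipodal_loop_not_contractible R m H gam) => //.
- apply: (continuous_compose (f := fun z => k (qd z)) _ (@cval _ _)).
  exact: continuous_compose cqd ck.
- move=> t; rewrite /H (_ : qd (1, t) = h (pt t)) ?hK //.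
  by apply: val_inj; rewrite /= /q /= c1 !mul1r -surjective_pairing.
- move=> t; rewrite /H (_ : qd (0, t) = qd (0, 0)) //.
  by apply: val_inj; rewrite /= /q /= c0 !mul0r.
- move=> s; rewrite /H (_ : qd (s, 1) = qd (s, 0)) //.
  by apply: val_inj; rewrite /= /q /= /l pt1.
Qed.
End ContractibleDisk.

(** * Coordinates in dimension three *)

Section Coordinates.
Local Notation o2 := (ord_max : 'I_3).

Lemma ord3P (P : 'I_3 -> Prop) : P 0 -> P 1 -> P o2 -> forall i, P i.
Proof.
move=> P0 P1 P2 [[|[|[|//]]] lt_i].
- by rewrite (_ : Ordinal lt_i = 0) //; exact: val_inj.
- by rewrite (_ : Ordinal lt_i = 1) //; exact: val_inj.
- by rewrite (_ : Ordinal lt_i = o2) //; exact: val_inj.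
Qed.

Lemma sum3E (M : nmodType) (F : 'I_3 -> M) : \sum_i F i = F 0 + F 1 + F o2.
Proof.
rewrite !big_ord_recl big_ord0 addr0 addrA; congr (F _ + F _ + F _);
  exact: val_inj.
Qed.

Lemma prod3E (A : pzRingType) (F : 'I_3 -> A) : \prod_i F i = F 0 * F 1 * F o2.
Proof.
rewrite !big_ord_recl big_ord0 mulr1 mulrA; congr (F _ * F _ * F _);
  exact: val_inj.
Qed.

End Coordinates.

Section ConicCone.
Context (R : realType).
Local Notation V := 'cV[R]_3.
Local Notation o2 := (ord_max : 'I_3).

Definition col3 (x y z : R) : V := \col_i nth 0 [:: x; y; z] i.

Lemma col3E x y z : ((col3 x y z 0 0 = x) * (col3 x y z 1 0 = y) *
  (col3 x y z o2 0 = z))%type.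
Proof. by rewrite !mxE. Qed.

Lemma col3P (u v : V) :
  u 0 0 = v 0 0 -> u 1 0 = v 1 0 -> u o2 0 = v o2 0 -> u = v.
Proof.
by move=> e0 e1 e2; apply/matrixP => i j; rewrite ord1; move: i; apply: ord3P.
Qed.

Lemma qevalZ (g : 'M[R]_3) k (v : V) : qeval g (k *: v) = k ^+ 2 * qeval g v.
Proof.
have -> : qeval g (k *: v) = ((k *: v^T) *m g *m (k *: v)) 0 0 by rewrite -linearZ.
by rewrite -!scalemxAl -scalemxAr scalerA mxE expr2.
Qed.

Lemma qeval_continuous (g : 'M[R]_3) : continuous (qeval g).
Proof.
have -> : qeval g = (fun v : V => \sum_j \sum_i (v i 0 * g i j) * v j 0).
  apply/funext => v; rewrite /qeval mxE; apply: eq_bigr => j _.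
  by rewrite mxE mulr_suml; apply: eq_bigr => i _; rewrite mxE.
move=> v; apply: continuous_at_sum => j; apply: continuous_at_sum => i.
apply: continuous_at_mul; last exact: coord_continuous.
by apply: continuous_at_mul; [exact: coord_continuous|exact: cst_continuous].
Qed.

(** * The inside of a conic *)

(** In suitable coordinates the form is c (x^2 + y^2 - z^2).  Its negative side
    z^2 > x^2 + y^2 is an open disk in the affine chart z = 1.  Through any
    point of its positive side passes the image of an arc of vectors from v to
    - v, so that no component of the positive side is a disk. *)
Section Inside.
Variables (g U : 'M[R]_3) (c : R).
Hypotheses (Uunit : U \in unitmx) (c0 : c != 0).
Hypothesis gE : forall v, qeval g v =
  c * ((U *m v) 0 0 ^+ 2 + (U *m v) 1 0 ^+ 2 - (U *m v) o2 0 ^+ 2).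

Let Neg : set (RP2 R) := [set p | c * qeval g (rep p) < 0].
(** The division by the squared norm makes the function scale-invariant. *)
Let N (p : RP2 R) : R := c * (qeval g (rep p) / dot (rep p) (rep p)).

Let cN : continuous N.
Proof.
move=> p; apply: (@continuous_at_mul R (RP2 R) p (fun=> c)).
  exact: cst_continuous.
apply: (@rep_comp_continuous _ _ _ _ (fun v => qeval g v / dot v v)).
  move=> k v k0 v0; rewrite qevalZ dotZl dotZr.
  have := dot_gt0 v0; move: (dot v v) => d d0; field.
  by rewrite k0 gt_eqF.
apply: continuous_at_mul; first exact: qeval_continuous.
apply: continuous_at_inv; first by rewrite gt_eqF // dot_gt0 // rep_neq0.
by apply: dot_continuous => ?.
Qed.

Let N_lt0 p : (N p < 0) = (c * qeval g (rep p) < 0).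
Proof. by rewrite /N mulrA pmulr_llt0 // invr_gt0 dot_gt0 ?rep_neq0. Qed.

Let N_neq0 p : (N p != 0) = (qeval g (rep p) != 0).
Proof.
rewrite /N !mulf_eq0 (negPf c0) invr_eq0.
by rewrite (gt_eqF (dot_gt0 (rep_neq0 p))) orbF.
Qed.

Let point_of_Neg (v : V) : v != 0 ->
  Neg (point_of v) <-> (U *m v) 0 0 ^+ 2 + (U *m v) 1 0 ^+ 2 < (U *m v) o2 0 ^+ 2.
Proof.
move=> v0; have [k k0 kE] := rep_point_of v0.
rewrite /Neg /= kE qevalZ gE mulrCA pmulr_rlt0; last first.
  by rewrite exprn_even_gt0.
by rewrite mulrA -expr2 pmulr_rlt0 ?subr_lt0 // exprn_even_gt0.
Qed.

Let NegP p : Neg p <-> (U *m rep p) 0 0 ^+ 2 + (U *m rep p) 1 0 ^+ 2 <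
  (U *m rep p) o2 0 ^+ 2.
Proof. by rewrite -{1}(point_of_rep p); apply: point_of_Neg; exact: rep_neq0. Qed.

Let affine_vec (z : R * R) : V :=
  z.1 *: (invmx U *m col3 1 0 0) + z.2 *: (invmx U *m col3 0 1 0)
  + invmx U *m col3 0 0 1.

Let affine_vecE z : U *m affine_vec z = col3 z.1 z.2 1.
Proof.
rewrite /affine_vec !mulmxDr -!scalemxAr !mulKVmx //.
by apply: col3P; rewrite !mxE /=; ring.
Qed.

Let affine_vec_neq0 z : affine_vec z != 0.
Proof.
apply/eqP => z0; have := affine_vecE z; rewrite z0 mulmx0 => /matrixP/(_ o2 0).
by rewrite !mxE /= => /eqP; rewrite eq_sym oner_eq0.
Qed.

Let affine_vec_continuous : continuous affine_vec.
Proof.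
move=> z; apply: (@cvgD R 'M[R]_(3, 1)); last exact: cvg_cst.
by apply: (@cvgD R 'M[R]_(3, 1)); apply: cvgZr_tmp; [exact: cvg_fst|exact: cvg_snd].
Qed.

Let chart z : RP2 R := point_of (affine_vec z).

Let chart_continuous : continuous chart.
Proof.
exact: (point_of_comp_continuous affine_vec_continuous affine_vec_neq0).
Qed.

Let chart_Neg z : Neg (chart z) <-> open_disk z.
Proof. by rewrite /chart point_of_Neg // affine_vecE !col3E expr1n. Qed.

Let coord i (p : RP2 R) : R := (U *m rep p) i 0 / (U *m rep p) o2 0.

Let coord_o2 p : Neg p -> (U *m rep p) o2 0 != 0.
Proof.
move=> /NegP; apply: contraTneq => ->.
by rewrite expr0n -leNgt addr_ge0 ?sqr_ge0.
Qed.

Let coord_chart z : (coord 0 (chart z), coord 1 (chart z)) = z.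
Proof.
rewrite /coord /chart; have [k k0 ->] := rep_point_of (affine_vec_neq0 z).
rewrite -!scalemxAr affine_vecE !mxE /= mulr1.
by rewrite (mulrC k) mulfK // (mulrC k) mulfK // -surjective_pairing.
Qed.

Let chart_coord p : Neg p -> chart (coord 0 p, coord 1 p) = p.
Proof.
move=> Ap; have z0 := coord_o2 Ap.
rewrite -[RHS]point_of_rep -(@point_ofZ _ _ _ ((U *m rep p) o2 0)^-1) ?invr_eq0 //.
  congr point_of; apply: (can_inj (mulKmx Uunit)); rewrite affine_vecE -scalemxAr.
  by apply: col3P; rewrite !col3E [RHS]mxE mulrC ?mulfV.
exact: rep_neq0.
Qed.

Let coord_disk p : Neg p -> open_disk (coord 0 p, coord 1 p).
Proof. by move=> Ap; apply/chart_Neg; rewrite chart_coord. Qed.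

(** A disk is star-shaped about its centre. *)
Let Neg_connected : connected Neg.
Proof.
pose B p := (fun t : R => chart (t * coord 0 p, t * coord 1 p)) @` `[0, 1]%classic.
have I0 : `[0, 1]%classic (0 : R) by rewrite /= in_itv /= lexx ler01.
have I1 : `[0, 1]%classic (1 : R) by rewrite /= in_itv /= lexx ler01.
have -> : Neg = \bigcup_(p in Neg) B p.
  apply/seteqP; split=> [p Ap | q [p Ap [t /= t01 <-]]].
    by exists p => //; exists 1 => //; rewrite !mul1r chart_coord.
  apply/chart_Neg; have := coord_disk Ap; rewrite /open_disk /=.
  move: (coord 0 p) (coord 1 p) => x y xy; rewrite !exprMn -mulrDr.
  apply: le_lt_trans xy; rewrite -[leRHS]mul1r; apply: ler_wpM2r.
    by rewrite addr_ge0 ?sqr_ge0.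
  by move: t01; rewrite in_itv /= => /andP[t0 t1]; rewrite exprn_ile1.
apply: bigcup_connected.
  by exists (chart (0, 0)) => p Ap; exists 0 => //; rewrite !mul0r.
move=> p Ap; apply: connected_continuous_connected; first exact: segment_connected.
apply: continuous_subspaceT => t.
have cpair : continuous (fun t : R => (t * coord 0 p, t * coord 1 p)).
  have cm (a : R) : continuous (fun t : R => t * a).
    move=> x; apply: (@continuous_at_mul R R x id (fun=> a)); first exact: cvg_id.
    exact: cst_continuous.
  exact: continuous_pair (cm _) (cm _).
exact: (continuous_compose cpair chart_continuous).
Qed.

Let Neg_sub_compl : Neg `<=` ~` locus g.
Proof. by move=> p; rewrite /Neg /= /locus /= => + g0; rewrite g0 mulr0 ltxx. Qed.

Let component_inside p : Neg p -> connected_component (~` locus g) p = Neg.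
Proof.
move=> Ap; apply/seteqP; split=> q; last first.
  by apply: connected_component_max => //.
move=> Cq; rewrite /Neg /= -N_lt0.
have cC := component_connected (A := ~` locus g) (x := p).
apply: (connected_same_sign cC _ _ _ _ Cq).
- by move=> z _; exact: cN.
- by move=> z /connected_component_sub gz; rewrite N_neq0; apply/eqP.
- by apply: connected_component_refl; exact: Neg_sub_compl.
- by rewrite N_lt0.
Qed.

Let coord_continuous_at i p : Neg p -> {for p, continuous (coord i)}.
Proof.
move=> Ap; have cU j v : {for v, continuous (fun v : V => (U *m v) j 0)}.
  have -> : (fun v : V => (U *m v) j 0) = fun v => \sum_k U j k * v k 0.
    by apply/funext => w; rewrite mxE.
  apply: continuous_at_sum => k; apply: continuous_at_mul.
    exact: cst_continuous.
  exact: coord_continuous.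
apply: (@rep_comp_continuous _ _ _ _ (fun v : V => (U *m v) i 0 / (U *m v) o2 0)).
  move=> k v k0 v0; rewrite -!scalemxAr !mxE invfM mulrACA divff // mul1r.
  by [].
apply: continuous_at_mul; first exact: cU.
apply: continuous_at_inv; last exact: cU.
exact: coord_o2.
Qed.

Let Neg_homeomorphic : homeomorphic (set_type Neg) (set_type (@open_disk R)).
Proof.
pose h (a : set_type Neg) : set_type (@open_disk R) :=
  exist _ (coord 0 (val a), coord 1 (val a)) (mem_set (coord_disk (set_valP a))).
pose k (d : set_type (@open_disk R)) : set_type Neg :=
  exist _ (chart (val d)) (mem_set ((chart_Neg (val d)).2 (set_valP d))).
exists h, k; split.
- apply: continuous_set_type.
  have cc i : continuous (fun a : set_type Neg => coord i (val a)).
    move=> a; apply: (cvg_comp set_val (coord i)); first exact: initial_continuous.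
    exact: (coord_continuous_at (set_valP a)).
  exact: continuous_pair (cc 0) (cc 1).
- apply: continuous_set_type.
  have cv : continuous (set_val : set_type (@open_disk R) -> R * R).
    exact: initial_continuous.
  exact: (continuous_compose cv chart_continuous).
- by move=> a; apply: val_inj; rewrite /= chart_coord //; exact: set_valP.
- by move=> d; apply: val_inj; rewrite /= coord_chart.
Qed.

(** In the coordinates (x, y, z) given by U, the vector [w] below is the
    projection of [v] on the plane (x, y), turned by a right angle: along the arc [gam] from v to - v the coordinate z is scaled by 1 - 2 t
    while x^2 + y^2 is scaled by at least (1 - 2 t)^2, so that the arc stays
    outside. *)
Let outside_not_disk p : 0 < c * qeval g (rep p) ->
  ~ homeomorphic (set_type (connected_component (~` locus g) p))
                 (set_type (@open_disk R)).
Proof.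
set v := rep p => gp hom.
pose w := invmx U *m col3 (- (U *m v) 1 0) ((U *m v) 0 0) 0.
pose gam (t : R) : V := (1 - 2 * t) *: v + (t * (1 - t)) *: w.
have gam_pos t : 0 < c * qeval g (gam t).
  move: gp; rewrite !gE /gam mulmxDr -!scalemxAr mulKVmx //.
  have cc X : (0 < c * (c * X)) = (0 < X).
    by rewrite mulrA -expr2 pmulr_rgt0 // exprn_even_gt0.
  rewrite !cc.
  move: (U *m v) => u; rewrite !mxE /= mulr0 addr0.
  move: (u 0 0) (u 1 0) (u o2 0) => x y z xyz.
  have xy : 0 < x ^+ 2 + y ^+ 2.
    by rewrite -(subr_gt0 _ (_ + _)) in xyz *; nra.
  rewrite (_ : _ - _ = (1 - 2 * t) ^+ 2 * (x ^+ 2 + y ^+ 2 - z ^+ 2) +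
    (t * (1 - t)) ^+ 2 * (x ^+ 2 + y ^+ 2)); last by ring.
  have [t2|t2] := eqVneq (1 - 2 * t) 0.
    rewrite t2 expr0n mul0r add0r mulr_gt0 // exprn_even_gt0 //=.
    by apply/eqP => tt; nra.
  apply: ltr_pwDl; last by rewrite mulr_ge0 ?sqr_ge0 ?(ltW xy).
  by rewrite mulr_gt0 // exprn_even_gt0.
have gam_neq0 t : gam t != 0.
  apply: contraTneq (gam_pos t) => ->.
  by rewrite -(scale0r (0 : V)) qevalZ expr0n mul0r mulr0 ltxx.
have gam_cont : continuous gam.
  move=> t; apply: (@cvgD R 'M[R]_(3, 1)); apply: cvgZr_tmp.
    apply: (@cvgB R R^o); first exact: cvg_cst.
    by apply: cvgM; [exact: cvg_cst|exact: cvg_id].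
  apply: cvgM; first exact: cvg_id.
  by apply: (@cvgB R R^o); [exact: cvg_cst|exact: cvg_id].
apply: (disk_no_antipodal_loop hom gam_cont gam_neq0).
  rewrite /gam !mulr1 !mulr0 subr0 subrr mulr0 mul0r !scale0r !addr0 scale1r.
  by rewrite (_ : 1 - 2 = -1) ?scaleN1r //; ring.
move=> t; apply: (connected_component_max (B := range (fun t => point_of (gam t)))).
- exists 0 => //; rewrite /gam mulr0 subr0 mul0r scale0r addr0 scale1r.
  exact: point_of_rep.
- move=> _ [s _ <-]; rewrite /= /locus /=.
  have [k k0 ->] := rep_point_of (gam_neq0 s); rewrite qevalZ.
  apply/eqP; rewrite mulf_neq0 ?expf_neq0 //.
  by apply: contraTneq (gam_pos s) => ->; rewrite mulr0 ltxx.
- apply: connected_continuous_connected.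
    exact/connected_intervalP.
  apply: continuous_subspaceT.
  exact: point_of_comp_continuous.
- by exists t.
Qed.

Lemma insideE : inside g = [set p | c * qeval g (rep p) < 0].
Proof.
apply/seteqP; split=> p /=.
  move=> [gp hom]; rewrite ltNge; apply/negP.
  rewrite le_eqVlt eq_sym mulf_eq0 (negPf c0) => /orP[/eqP //|].
  by move=> /outside_not_disk; apply.
move=> Ap; split; first exact: Neg_sub_compl.
by rewrite component_inside.
Qed.

End Inside.

End ConicCone.

(** * Nested conics in normal form *)

Section NormalForm.
Context (R : realType).
Local Notation V := 'cV[R]_3.
Local Notation o2 := (ord_max : 'I_3).

Definition diag3 (x y z : R) : 'M[R]_3 := diag_mx (\row_i nth 0 [:: x; y; z] i).

Lemma det_diag3 x y z : \det (diag3 x y z) = x * y * z.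
Proof. by rewrite det_diag prod3E !mxE. Qed.

Lemma diag3_mulE x y z (v : V) : ((diag3 x y z *m v) 0 0 = x * v 0 0) *
  ((diag3 x y z *m v) 1 0 = y * v 1 0) * ((diag3 x y z *m v) o2 0 = z * v o2 0).
Proof. by rewrite /diag3 mul_diag_mx !mxE. Qed.

Lemma qeval_diag (U : 'M[R]_3) (k x y z : R) (v : V) :
  qeval (k *: (U^T *m diag3 x y z *m U)) v =
  k * (x * (U *m v) 0 0 ^+ 2 + y * (U *m v) 1 0 ^+ 2 + z * (U *m v) o2 0 ^+ 2).
Proof.
have -> : qeval (k *: (U^T *m diag3 x y z *m U)) v =
          (k *: ((U *m v)^T *m diag3 x y z *m (U *m v))) 0 0.
  by rewrite /qeval -scalemxAr -scalemxAl trmx_mul !mulmxA.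
move: (U *m v) => u; rewrite mxE; congr (_ * _).
rewrite mxE sum3E !mxE !sum3E !mxE /=; ring.
Qed.

(** On [f = 0] one has s (z^2 - x^2) = x^2 + y^2 + z^2 > 0, and there the form
    of g equals (t - s) (x^2 - z^2) up to the factor m: it has the constant
    sign of s - t. *)
Lemma lies_inside_diag3 U (f g : 'M[R]_3) (l m s t : R) : U \in unitmx ->
  l != 0 -> m != 0 -> 1 < s -> 1 < t -> locus f !=set0 ->
  f = l *: (U^T *m diag3 (1 + s) 1 (1 - s) *m U) ->
  g = m *: (U^T *m diag3 (1 + t) 1 (1 - t) *m U) ->
  lies_inside f g <-> s < t.
Proof.
move=> Uu l0 m0 s1 t1 [p0 fp0] fE gE.
pose S := diag3 (Num.sqrt (1 + t)) 1 (Num.sqrt (t - 1)).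
have Su : S \in unitmx.
  by rewrite unitmxE det_diag3 unitfE mulr1 mulf_neq0 // gt_eqF // sqrtr_gt0; lra.
(* rescaling the coordinates turns the form of g into x^2 + y^2 - z^2 *)
have inE : inside g = [set p | m * qeval g (rep p) < 0].
  apply: (@insideE _ _ (S *m U)) => //; first by rewrite unitmx_mul Su.
  move=> v; rewrite gE qeval_diag -mulmxA !diag3_mulE !exprMn.
  by rewrite !sqr_sqrtr; [ring|lra|lra].
have key p : locus f p -> (m * qeval g (rep p) < 0) = (s < t).
  rewrite /locus /= fE gE !qeval_diag.
  have : U *m rep p != 0
    by apply: contraNneq (rep_neq0 p) => Up; rewrite -(mulKmx Uu (rep p)) Up mulmx0.
  move: (U *m rep p) => u u0 /eqP.
  rewrite mulf_eq0 (negPf l0) /= => /eqP fu.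
  rewrite mulrA -expr2 pmulr_rlt0 ?exprn_even_gt0 //.
  have := dot_gt0 u0; rewrite /dot sum3E -!expr2; move: fu.
  move: (u 0 0 ^+ 2) (u 1 0 ^+ 2) (u o2 0 ^+ 2) => x y z fu xyz.
  rewrite (_ : _ + _ = (t - s) * (x - z)).
    rewrite nmulr_llt0 ?subr_gt0 //.
    rewrite -(pmulr_rlt0 _ (lt_trans ltr01 s1)); lra.
  lra.
rewrite /lies_inside inE; split => [/(_ _ fp0) /=|st p fp /=]; by rewrite key.
Qed.
End NormalForm.

(** * Normal form of the couples in class IaN *)

Section PencilNormalForm.
Context (R : realType).
Local Notation V := 'cV[R]_3.
Local Notation o2 := (ord_max : 'I_3).

(** The coordinates (x + z) / sqrt 2, y, (x - z) / sqrt 2 diagonalize all the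
    forms of the pencil of x^2 + y^2 + z^2 and xz.  The parameter is a sign:
    e = -1 replaces z by - z, hence xz by its opposite. *)
Definition eigenframe (e : R) : 'M[R]_3 :=
  let r := Num.sqrt 2^-1 in
  mx3_of_rows [:: [:: r; 0; e * r]; [:: 0; 1; 0]; [:: r; 0; - (e * r)]].

Lemma eigenframe_diag e s : e ^+ 2 = 1 ->
  (eigenframe e)^T *m diag3 (1 + e * s) 1 (1 - e * s) *m eigenframe e =
  1%:M + (2 * s) *: xz_form R.
Proof.
move=> e2; have : Num.sqrt (2^-1 : R) ^+ 2 = 2^-1 by rewrite sqr_sqrtr.
rewrite /eigenframe; move: (Num.sqrt _) => r r2.
have h : 2 * r ^+ 2 = 1 by rewrite r2 mulfV // pnatr_eq0.
apply/matrixP; elim/ord3P; elim/ord3P;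
  rewrite !mxE sum3E !mxE !sum3E !mxE /= ?(mulr0, mul0r, mulr1, mul1r, addr0, add0r) //.
- by transitivity (2 * r ^+ 2); [ring|exact: h].
- by transitivity ((2 * r ^+ 2) * e ^+ 2 * s); [ring|rewrite h e2; field].
- by transitivity ((2 * r ^+ 2) * e ^+ 2 * s); [ring|rewrite h e2; field].
- by transitivity ((2 * r ^+ 2) * e ^+ 2); [ring|rewrite h e2 mulr1].
Qed.

Lemma diag3_form (a b e : R) : a != 0 -> e ^+ 2 = 1 ->
  a *: 1%:M + b *: xz_form R =
  a *: ((eigenframe e)^T *m
    diag3 (1 + e * (b / (2 * a))) 1 (1 - e * (b / (2 * a))) *m eigenframe e).
Proof.
move=> a0 e2; rewrite eigenframe_diag // scalerDr scalerA; congr (_ + _ *: _).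
by field.
Qed.

Lemma eigenframe_unit e : e ^+ 2 = 1 -> eigenframe e \in unitmx.
Proof.
move=> e2; have := eigenframe_diag 0 e2; rewrite !mulr0 subr0 addr0 scale0r addr0.
have -> : diag3 1 1 1 = 1%:M :> 'M[R]_3.
  by apply/matrixP; elim/ord3P; elim/ord3P; rewrite !mxE.
by rewrite mulmx1 => /mulmx1_unit[].
Qed.

Lemma det_form (a b : R) :
  \det (a *: 1%:M + b *: xz_form R) = a * (a - b / 2) * (a + b / 2).
Proof.
have [->|a0] := eqVneq a 0.
  rewrite scale0r add0r !mul0r detZ; apply/eqP; rewrite mulf_eq0; apply/orP; right.
  apply/det0P; exists (delta_mx 0 1).
    by apply/eqP => /matrixP/(_ 0 1)/eqP; rewrite !mxE /= oner_eq0.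
  by apply/rowP; elim/ord3P; rewrite !mxE sum3E !mxE /=; ring.
rewrite (diag3_form _ a0 (expr1n _ 2)) detZ !det_mulmx det_tr det_diag3.
have := congr1 determinant (eigenframe_diag 0 (expr1n _ 2)).
rewrite !det_mulmx det_tr det_diag3 !mulr0 scale0r subr0 !addr0 det1 !mulr1.
move: (\det _) => d dd.
rewrite [LHS](_ : _ = (d * d) *
  (a ^+ 3 * ((1 + b / (2 * a)) * (1 - b / (2 * a))))); last by ring.
by rewrite dd; field.
Qed.

(** The form a (x^2 + y^2 + z^2) + b xz has the eigenvalues a (1 + slope), a,
    a (1 - slope).  So the degenerate conics of the pencil are at the slopes 1,
    - 1 and infinity, and the empty ones between - 1 and 1. *)
Definition slope (a b : R) : R := b / (2 * a).

Lemma congruence_diag3 (P : 'M[R]_3) a b e : a != 0 -> e ^+ 2 = 1 ->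
  P^T *m (a *: 1%:M + b *: xz_form R) *m P =
  a *: ((eigenframe e *m P)^T *m diag3 (1 + e * slope a b) 1 (1 - e * slope a b)
         *m (eigenframe e *m P)).
Proof.
move=> a0 e2; rewrite (diag3_form b a0 e2) -scalemxAr -scalemxAl trmx_mul.
by rewrite !mulmxA.
Qed.

(** Between - 1 and 1 the form is definite. *)
Lemma slope_outside (P : 'M[R]_3) a b : P \in unitmx -> a != 0 ->
  \det (P^T *m (a *: 1%:M + b *: xz_form R) *m P) != 0 ->
  locus (P^T *m (a *: 1%:M + b *: xz_form R) *m P) !=set0 ->
  slope a b < -1 \/ 1 < slope a b.
Proof.
move=> Pu a0 det0 [p]; rewrite /locus /=.
rewrite (@congruence_diag3 _ _ _ 1) ?expr1n // qeval_diag !mul1r.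
have : eigenframe 1 *m P *m rep p != 0.
  apply: contraNneq (rep_neq0 p) => Up.
  have Uu : eigenframe 1 *m P \in unitmx by rewrite unitmx_mul eigenframe_unit ?expr1n.
  by rewrite -(mulKmx Uu (rep p)) Up mulmx0.
move: (eigenframe 1 *m P *m rep p) => u /dot_gt0; rewrite /dot sum3E -!expr2.
have := sqr_ge0 (u 0 0); have := sqr_ge0 (u 1 0); have := sqr_ge0 (u o2 0).
move: (u 0 0 ^+ 2) (u 1 0 ^+ 2) (u o2 0 ^+ 2) => x y z z0 y0 x0 xyz /eqP.
rewrite mulf_eq0 (negPf a0) /= => /eqP quad.
have s1 : slope a b != 1 /\ slope a b != -1.
  move: det0; rewrite !det_mulmx det_form !mulf_eq0 !negb_or.
  rewrite (negPf a0) /= => /andP[/andP[_ /andP[d1 d2]] _]; rewrite /slope.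
  split; [apply: contraNneq d1|apply: contraNneq d2] => /(congr1 ( *%R^~ (2 * a))).
    by rewrite divfK ?mulf_neq0 ?pnatr_eq0 // => ->; apply/eqP; field.
  by rewrite divfK ?mulf_neq0 ?pnatr_eq0 // => ->; apply/eqP; field.
case: s1 => s1 s2.
have [s_le|s_gt] := leP (slope a b) 1; last by right.
have s_lt : slope a b < 1 by rewrite lt_neqAle s1.
left; rewrite lt_neqAle s2 /= leNgt; apply/negP => s_gt.
have hx : 0 <= (1 + slope a b) * x by rewrite mulr_ge0 //; lra.
have hz : 0 <= (1 - slope a b) * z by rewrite mulr_ge0 //; lra.
have /eqP : (1 + slope a b) * x = 0 by lra.
have /eqP : (1 - slope a b) * z = 0 by lra.
rewrite !mulf_eq0 => /orP[/eqP|/eqP z_0]; first by lra.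
by move=> /orP[/eqP|/eqP x_0]; lra.
Qed.

Lemma congruenceD (P A B : 'M[R]_3) a b :
  P^T *m (a *: A + b *: B) *m P = a *: (P^T *m A *m P) + b *: (P^T *m B *m P).
Proof. by rewrite mulmxDr mulmxDl -!scalemxAr -!scalemxAl. Qed.

Lemma pencil_coef (f g P h : 'M[R]_3) :
    pencil f g = pencil (P^T *m 1%:M *m P) (P^T *m xz_form R *m P) ->
    \det h != 0 -> (exists a b, h = a *: f + b *: g) ->
  exists2 a, a != 0 & exists b, h = P^T *m (a *: 1%:M + b *: xz_form R) *m P.
Proof.
move=> pE hdet [a0 [b0 hE]].
have h0 : h != 0 by apply: contraNneq hdet => ->; rewrite det0.
have [c c0 cE] := rep_point_of h0.
have : pencil f g (point_of h).
  by exists (c * a0), (c * b0); rewrite cE hE scalerDr !scalerA.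
rewrite pE => -[a [b abE]].
have hE2 : h = P^T *m ((a / c) *: 1%:M + (b / c) *: xz_form R) *m P.
  rewrite congruenceD !(mulrC _ c^-1) -!scalerA -scalerDr -abE cE scalerA mulVf //.
  by rewrite scale1r.
exists (a / c); last by exists (b / c).
apply: contraNneq hdet => a_0; rewrite hE2 !det_mulmx det_form a_0 !mul0r mulr0.
by rewrite mul0r.
Qed.

Lemma scale_mxE k (A : 'M[R]_3) i j : (k *: A) i j = k * A i j.
Proof. by rewrite mxE. Qed.

(** The slope of a conic of the pencil, read off the entries of its matrix in
    the coordinates given by [P]. *)
Definition slope_at (P : 'M[R]_3) (p : conic R) : R :=
  ((invmx P)^T *m rep p *m invmx P) 0 o2 / ((invmx P)^T *m rep p *m invmx P) 0 0.

Lemma congruenceK (P K : 'M[R]_3) : P \in unitmx ->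
  (invmx P)^T *m (P^T *m K *m P) *m invmx P = K.
Proof.
move=> Pu; rewrite !mulmxA -trmx_mul mulmxV // trmx1 mul1mx.
by rewrite -!mulmxA mulmxV // mulmx1.
Qed.

Lemma form_coord (a b : R) : ((a *: 1%:M + b *: xz_form R) 0 0 = a) *
  ((a *: 1%:M + b *: xz_form R) 0 o2 = b / 2).
Proof. by rewrite !mxE /= mulr1n !(mulr0, mulr0n, addr0, mulr1, add0r). Qed.

Lemma slope_atE (P : 'M[R]_3) p k a b : P \in unitmx -> a != 0 -> k != 0 ->
  rep p = k *: (P^T *m (a *: 1%:M + b *: xz_form R) *m P) ->
  slope_at P p = slope a b.
Proof.
move=> Pu a0 k0 pE; rewrite /slope_at pE -scalemxAr -scalemxAl congruenceK //.
rewrite !scale_mxE !form_coord /slope; field.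
by rewrite a0 k0.
Qed.

Lemma slope_at_continuous (P : 'M[R]_3) (p : conic R) :
  ((invmx P)^T *m rep p *m invmx P) 0 0 != 0 -> {for p, continuous (slope_at P)}.
Proof.
set Q := invmx P; move=> K0.
have cU i j w : {for w, continuous (fun v : 'M[R]_3 => (Q^T *m v *m Q) i j)}.
  have -> : (fun v : 'M[R]_3 => (Q^T *m v *m Q) i j) =
     fun v => \sum_k \sum_l Q^T i l * v l k * Q k j.
    apply/funext => v; rewrite mxE; apply: eq_bigr => k _.
    by rewrite mxE mulr_suml.
  apply: continuous_at_sum => k; apply: continuous_at_sum => l.
  apply: continuous_at_mul; last exact: cst_continuous.
  apply: continuous_at_mul; first exact: cst_continuous.
  exact: coord_continuous.
apply: (@rep_comp_continuous _ _ _ _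
  (fun v => (Q^T *m v *m Q) 0 o2 / (Q^T *m v *m Q) 0 0)).
  move=> c v c0 v0; rewrite -scalemxAr -scalemxAl !scale_mxE.
  by rewrite invfM mulrACA divff // mul1r.
apply: continuous_at_mul; first exact: cU.
by apply: continuous_at_inv => //; exact: cU.
Qed.

(** An arc is connected and contains no conic of slope 1. *)
Lemma same_arc_slope (f g P : 'M[R]_3) a b a' b' : P \in unitmx ->
    pencil f g = pencil (P^T *m 1%:M *m P) (P^T *m xz_form R *m P) ->
    a != 0 -> a' != 0 -> \det f != 0 -> \det g != 0 ->
    f = P^T *m (a *: 1%:M + b *: xz_form R) *m P ->
    g = P^T *m (a' *: 1%:M + b' *: xz_form R) *m P ->
  same_arc f g -> 1 < slope a b -> 1 < slope a' b'.
Proof.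
move=> Pu pE a0 a'0 df dg fE gE [B [Bf Bsub Bc] Bg] sf.
have Bform p : B p -> exists a b, [/\ a != 0, slope a b != 1 &
    rep p = P^T *m (a *: 1%:M + b *: xz_form R) *m P].
  move=> /Bsub [pp]; rewrite /proper_conic /= => dp.
  move: pp; rewrite pE => -[c [d cdE]].
  have cdE2 : rep p = P^T *m (c *: 1%:M + d *: xz_form R) *m P by rewrite congruenceD.
  move: dp; rewrite cdE2 !det_mulmx det_form !mulf_eq0 !negb_or.
  move=> /andP[/andP[_ /andP[/andP[c0 d1] _]] _]; exists c, d; split=> //.
  apply: contraNneq d1 => /(congr1 ( *%R^~ (2 * c))).
  by rewrite /slope divfK ?mulf_neq0 ?pnatr_eq0 // => ->; apply/eqP; field.
have slope_pt h c d : c != 0 -> \det h != 0 ->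
    h = P^T *m (c *: 1%:M + d *: xz_form R) *m P ->
    slope_at P (point_of h) = slope c d.
  move=> c0 dh hE; have h0 : h != 0 by apply: contraNneq dh => ->; rewrite det0.
  have [k k0 kE] := rep_point_of h0.
  by apply: (slope_atE (k := k)) => //; rewrite kE -hE.
rewrite -(slope_pt g) // -subr_lt0.
apply: (connected_same_sign (N := fun p => 1 - slope_at P p) Bc _ _ Bf _ Bg).
- move=> p; rewrite inE => /Bform[c [d [c0 _ cdE]]].
  apply: (@continuous_at_sub R (conic R) p (fun=> 1)); first exact: cst_continuous.
  by apply: slope_at_continuous; rewrite cdE congruenceK // form_coord.
- move=> p /Bform[c [d [c0 s1 cdE]]].
  rewrite (@slope_atE P p 1 c d) ?oner_neq0 ?scale1r // subr_eq0 eq_sym.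
  exact: s1.
- by rewrite (slope_pt f a b) // subr_lt0.
Qed.

(** Both slopes are greater than 1 in absolute value and have the same sign,
    which the choice of the sign [e] makes positive. *)
Lemma IaN_normal_form (f g : 'M[R]_3) : \det f != 0 -> \det g != 0 ->
    class_IaN f g ->
  exists U l m s t, [/\ U \in unitmx, l != 0, m != 0, 1 < s & 1 < t] /\
    [/\ s != t, f = l *: (U^T *m diag3 (1 + s) 1 (1 - s) *m U) &
                g = m *: (U^T *m diag3 (1 + t) 1 (1 - t) *m U)].
Proof.
move=> df dg [fg_neq [_ f0] [_ g0] [P Pu pE] arc].
have [a a0 [b fE]] : exists2 a, a != 0 &
    exists b, f = P^T *m (a *: 1%:M + b *: xz_form R) *m P.
  by apply: (pencil_coef pE) => //; exists 1, 0; rewrite scale1r scale0r addr0.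
have [a' a'0 [b' gE]] : exists2 a, a != 0 &
    exists b, g = P^T *m (a *: 1%:M + b *: xz_form R) *m P.
  by apply: (pencil_coef pE) => //; exists 0, 1; rewrite scale1r scale0r add0r.
have sf : slope a b < -1 \/ 1 < slope a b.
  by apply: (slope_outside Pu a0); rewrite -fE.
have sg : slope a' b' < -1 \/ 1 < slope a' b'.
  by apply: (slope_outside Pu a'0); rewrite -gE.
have arc' : same_arc g f.
  rewrite /same_arc (_ : pencil g f = pencil f g).
    exact: connected_component_sym.
  by apply/seteqP; split=> p [x [y pxy]]; exists y, x; rewrite pxy addrC.
have pE' : pencil g f = pencil (P^T *m 1%:M *m P) (P^T *m xz_form R *m P).
  by rewrite -pE; apply/seteqP; split=> p [x [y pxy]]; exists y, x; rewrite pxy addrC.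
have fg := same_arc_slope Pu pE a0 a'0 df dg fE gE arc.
have gf := same_arc_slope Pu pE' a'0 a0 dg df gE fE arc'.
have [e [e2 ef eg]] : exists e : R,
    [/\ e ^+ 2 = 1, 1 < e * slope a b & 1 < e * slope a' b'].
  case: sf => [sf|sf]; last by exists 1; rewrite expr1n !mul1r; split=> //; exact: fg.
  exists (-1); rewrite sqrrN expr1n !mulN1r; split=> //; first by lra.
  case: sg => [sg|/gf]; lra.
have Uu : eigenframe e *m P \in unitmx by rewrite unitmx_mul eigenframe_unit.
exists (eigenframe e *m P), a, a', (e * slope a b), (e * slope a' b').
split; first by split.
have fE' := congruence_diag3 P b a0 e2; have gE' := congruence_diag3 P b' a'0 e2.
split; [|by rewrite fE|by rewrite gE].
apply/eqP => st; apply: fg_neq.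
have g_neq0 : g != 0 by apply: contraNneq dg => ->; rewrite det0.
rewrite (_ : f = (a / a') *: g) ?point_ofZ ?mulf_neq0 ?invr_eq0 //.
by rewrite fE gE fE' gE' st scalerA divfK.
Qed.

End PencilNormalForm.

(** * Determinants and the resultant in small dimension *)

Section SmallDeterminants.

(** With entries given by a function of natural numbers, the expansion along
    the first row can be iterated without dealing with ordinals. *)
Definition det_fun (A : comPzRingType) n (F : nat -> nat -> A) : A :=
  \det (\matrix_(i < n, j < n) F i j).

Lemma det_fun0 (A : comPzRingType) (F : nat -> nat -> A) : det_fun 0 F = 1.
Proof. exact: det_mx00. Qed.

Lemma det_funS (A : comPzRingType) n (F : nat -> nat -> A) :
  det_fun n.+1 F = \sum_(j < n.+1)
    F 0%N j * ((-1) ^+ j * det_fun n (fun i k => F i.+1 (bump j k))).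
Proof.
rewrite /det_fun (expand_det_row _ ord0); apply: eq_bigr => j _.
rewrite mxE /cofactor add0n; congr (_ * (_ * \det _)).
by apply/matrixP => i k; rewrite !mxE.
Qed.

Lemma det3E (A : comPzRingType) (M : 'M[A]_3) : \det M =
  M 0 0 * (M 1 1 * M ord_max ord_max - M 1 ord_max * M ord_max 1)
  - M 0 1 * (M 1 0 * M ord_max ord_max - M 1 ord_max * M ord_max 0)
  + M 0 ord_max * (M 1 0 * M ord_max 1 - M 1 1 * M ord_max 0).
Proof.
have -> : \det M = det_fun 3 (fun i j => M (inord i) (inord j)).
  by congr (\det _); apply/matrixP => i j; rewrite mxE !inord_val.
have i0 : inord 0 = 0 :> 'I_3 by apply: val_inj; rewrite /= inordK.
have i1 : inord 1 = 1 :> 'I_3 by apply: val_inj; rewrite /= inordK.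
have i2 : inord 2 = ord_max :> 'I_3 by apply: val_inj; rewrite /= inordK.
do 3 (rewrite !det_funS !big_ord_recl !big_ord0 /= /bump /= ?add1n ?add0n).
rewrite !det_fun0 i0 i1 i2; ring.
Qed.

Lemma resultant_cubic_linear (A : comNzRingType) (p q : {poly A}) :
  size p = 4%N -> size q = 2%N ->
  resultant p q = p`_0 * q`_1 ^+ 3 - p`_1 * q`_0 * q`_1 ^+ 2
                  + p`_2 * q`_0 ^+ 2 * q`_1 - p`_3 * q`_0 ^+ 3.
Proof.
move=> sp sq; rewrite /resultant.
move: (Sylvester_mx p q) (@Sylvester_mxE _ p q); rewrite sp sq => S SE.
pose F (i j : nat) : A :=
  if i == 0%N then p`_j else if (i.-1 <= j)%N then q`_(j - i.-1) else 0.
have -> : \det S = det_fun 4 F.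
  congr (\det _); apply/matrixP => i j; rewrite SE mxE /F.
  case: splitP => k ->; first by rewrite ord1 subn0 mulr1n.
  by rewrite /=; case: leqP.
do 4 (rewrite !det_funS !big_ord_recl !big_ord0 /= /bump /= ?add1n ?add0n).
rewrite !det_fun0 /F /=.
have q2 : q`_2 = 0 by rewrite nth_default ?sq.
have q3 : q`_3 = 0 by rewrite nth_default ?sq.
rewrite ?subSS ?subn0 ?sub0n ?q2 ?q3.
ring.
Qed.
End SmallDeterminants.

(** * The polynomials phi and psi of a pencil in normal form *)

Section PencilPolynomials.
Local Notation o2 := (ord_max : 'I_3).

Definition minors2 (A : comPzRingType) (M : 'M[A]_3) : A :=
  (M 1 1 * M o2 o2 - M 1 o2 * M o2 1) + (M 0 0 * M o2 o2 - M 0 o2 * M o2 0)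
  + (M 0 0 * M 1 1 - M 0 1 * M 1 0).

Lemma char_poly3_coef1 (A : comNzRingType) (M : 'M[A]_3) :
  (char_poly M)`_1 = minors2 M.
Proof.
have -> : char_poly M = 'X^3 - (M 0 0 + M 1 1 + M o2 o2)%:P * 'X^2
   + (minors2 M)%:P * 'X - (\det M)%:P.
  rewrite /char_poly det3E /char_poly_mx !mxE /= !mulr1n !mulr0n !sub0r.
  rewrite det3E /minors2 !(polyCD, polyCB, polyCM, polyCN); ring.
rewrite !(coefD, coefB, coefN, coefCM, coefXn, coefX, coefC) /=.
by rewrite mulr0 mulr1 !subr0 add0r.
Qed.

(** The squared norm of the cross product of the rows i and j of U. *)
Definition cross_sq (A : comPzRingType) (U : 'M[A]_3) (i j : 'I_3) : A :=
  (U i 0 * U j 1 - U i 1 * U j 0) ^+ 2 + (U i 0 * U j o2 - U i o2 * U j 0) ^+ 2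
  + (U i 1 * U j o2 - U i o2 * U j 1) ^+ 2.

(** The hypothesis says that M = U^T D U with D = diag (x, y, z).  By
    multiplicativity of the adjugate, the trace of adj M is that of
    adj D (adj U)^T adj U, and the diagonal entries of (adj U)^T adj U are the
    squared norms of the cross products of the rows of U. *)
Lemma minors2_congruence (A : comPzRingType) (U M : 'M[A]_3) (x y z : A) :
  (forall i j, M i j =
    U 0 i * x * U 0 j + U 1 i * y * U 1 j + U o2 i * z * U o2 j) ->
  minors2 M = cross_sq U 1 o2 * (y * z) + cross_sq U 0 o2 * (x * z)
    + cross_sq U 0 1 * (x * y).
Proof. move=> ME; rewrite /minors2 /cross_sq !ME; ring. Qed.

Lemma det_congruence (A : comPzRingType) (U M : 'M[A]_3) (x y z : A) :
  (forall i j, M i j =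
    U 0 i * x * U 0 j + U 1 i * y * U 1 j + U o2 i * z * U o2 j) ->
  \det M = (\det U) ^+ 2 * (x * y * z).
Proof. move=> ME; rewrite !det3E !ME; ring. Qed.

(** Expand the determinant along the row k other than i and j. *)
Lemma cross_sq_gt0 (A : realDomainType) (U : 'M[A]_3) : \det U != 0 ->
  [/\ 0 < cross_sq U 1 o2, 0 < cross_sq U 0 o2 & 0 < cross_sq U 0 1].
Proof.
move=> dU.
have pos i j (k : 'I_3) (e : A) : \det U = e *
    (U k 0 * (U i 1 * U j o2 - U i o2 * U j 1)
    - U k 1 * (U i 0 * U j o2 - U i o2 * U j 0)
    + U k o2 * (U i 0 * U j 1 - U i 1 * U j 0)) -> 0 < cross_sq U i j.
  move=> dE; rewrite lt_neqAle !addr_ge0 ?sqr_ge0 // andbT eq_sym.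
  apply: contraNneq dU => /eqP.
  rewrite !paddr_eq0 ?addr_ge0 ?sqr_ge0 // !sqrf_eq0.
  move=> /andP[/andP[/eqP x0 /eqP y0] /eqP z0].
  by rewrite dE x0 y0 z0 !mulr0 subrr addr0 mulr0.
split; [apply: (pos 1 o2 0 1)|apply: (pos 0 o2 1 (-1))|apply: (pos 0 1 o2 1)];
  by rewrite det3E; ring.
Qed.

Section Pencil.
Variables (R : realType) (U f g : 'M[R]_3) (l m s t : R).
Hypothesis fE : f = l *: (U^T *m diag3 (1 + s) 1 (1 - s) *m U).
Hypothesis gE : g = m *: (U^T *m diag3 (1 + t) 1 (1 - t) *m U).

Let D (x y : R) : {poly R} := (l * x)%:P * 'X + (m * y)%:P.

Let pencil_mxE i j : pencil_mx f g i j =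
  map_mx polyC U 0 i * D (1 + s) (1 + t) * map_mx polyC U 0 j
  + map_mx polyC U 1 i * D 1 1 * map_mx polyC U 1 j
  + map_mx polyC U o2 i * D (1 - s) (1 - t) * map_mx polyC U o2 j.
Proof.
rewrite /pencil_mx fE gE /D !mxE !sum3E !mxE !sum3E !mxE /=.
rewrite !(polyCD, polyCM, polyCN, mulr0n, mulr1n, polyC0) -!polyCM; ring.
Qed.

Lemma phiE : phi f g = ((\det U) ^+ 2)%:P *
  (D (1 + s) (1 + t) * D 1 1 * D (1 - s) (1 - t)).
Proof.
by rewrite /phi (det_congruence pencil_mxE) det_map_mx polyC_exp.
Qed.

Lemma psiE : psi f g = (cross_sq U 1 o2)%:P * (D 1 1 * D (1 - s) (1 - t))
  + (cross_sq U 0 o2)%:P * (D (1 + s) (1 + t) * D (1 - s) (1 - t))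
  + (cross_sq U 0 1)%:P * (D (1 + s) (1 + t) * D 1 1).
Proof.
rewrite /psi char_poly3_coef1 (minors2_congruence pencil_mxE).
have cofE i j : cross_sq (map_mx polyC U) i j = (cross_sq U i j)%:P.
  by rewrite /cross_sq !mxE !(polyCD, polyC_exp, polyCN, polyCM).
by rewrite !cofE.
Qed.
End Pencil.

End PencilPolynomials.

(** * The invariants in terms of the roots of phi *)

(** The polynomial phi has three distinct real roots t_i.  At such a root the
    value of Q is w_i phi' (t_i), where w_i = phi'' (t_i) psi (t_i) Phi30 / 2
    is the weight [w0], [w1] or [w2] below, so that Lagrange interpolation gives
    Q = Phi30 * \sum_i w_i (X - t_j) (X - t_k).  It follows that q2 / Phi30 and
    B1 / Phi30^3 are the upper left entry and the determinant of the matrix of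
    the quadratic form \sum_i w_i (x + t_i y)^2. *)
Section InvariantsFromRoots.
Variables (R : realType) (f g : 'M[R]_3) (k t0 t1 t2 e0 e1 e2 : R).
Hypotheses (k0 : k != 0) (t01 : t0 != t1) (t02 : t0 != t2) (t12 : t1 != t2).
Hypothesis phi_split :
  phi f g = k *: (('X - t0%:P) * ('X - t1%:P) * ('X - t2%:P)).
Hypotheses (psi0 : (psi f g).[t0] = e0) (psi1 : (psi f g).[t1] = e1)
  (psi2 : (psi f g).[t2] = e2).

Let a := - k * (t0 + t1 + t2).
Let b := k * (t0 * t1 + t0 * t2 + t1 * t2).
Let c := - k * (t0 * t1 * t2).

Let phi_horner : phi f g = ((k%:P * 'X + a%:P) * 'X + b%:P) * 'X + c%:P.
Proof.
by rewrite phi_split -mul_polyC /a /b /c !(polyCD, polyCN, polyCM); ring.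
Qed.

Lemma Phi_split : [/\ Phi30 f g = k, Phi21 f g = a, Phi12 f g = b & Phi03 f g = c].
Proof.
rewrite /Phi30 /Phi21 /Phi12 /Phi03 phi_horner.
by split; rewrite !(coefD, coefMX, coefC, coefCM) /= ?(addr0, add0r).
Qed.

Let size_phi : size (phi f g) = 4%N.
Proof.
rewrite phi_horner.
have s1 : size (k%:P * 'X + a%:P) = 2%N.
  by rewrite size_MXaddC polyC_eq0 (negPf k0) /= size_polyC k0.
have s2 : size ((k%:P * 'X + a%:P) * 'X + b%:P) = 3%N.
  by rewrite size_MXaddC s1 -size_poly_eq0 s1.
by rewrite size_MXaddC s2 -size_poly_eq0 s2.
Qed.

Let dphiE : (phi f g)^`() = (3 * k)%:P * 'X^2 + (2 * a)%:P * 'X + b%:P.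
Proof.
rewrite phi_horner !(derivD, derivM, derivC, derivX, derivXn).
rewrite !(polyCD, polyCN, polyCM); ring.
Qed.

Let ddphiE : (phi f g)^`(2) = (6 * k)%:P * 'X + (2 * a)%:P.
Proof.
rewrite derivSn derivn1 dphiE !(derivD, derivM, derivC, derivX, derivXn).
rewrite !(polyCD, polyCN, polyCM); ring.
Qed.

(** Up to the factor 8 Phi30^4 and the sign, the resultant is the product of the
    values of phi'' / (2 Phi30) at the three roots. *)
Lemma Rinv_split : Rinv f g =
  - k ^+ 3 * ((2 * t0 - t1 - t2) * (2 * t1 - t0 - t2) * (2 * t2 - t0 - t1)).
Proof.
have k6 : 6 * k != 0 by rewrite mulf_neq0 // pnatr_eq0.
have [k30 k21 k12 k03] := Phi_split.
rewrite /Rinv resultant_cubic_linear //; last first.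
  by rewrite ddphiE size_MXaddC polyC_eq0 (negPf k6) /= size_polyC k6.
rewrite -/(Phi30 f g) -/(Phi21 f g) -/(Phi12 f g) -/(Phi03 f g) k30 k21 k12 k03.
rewrite ddphiE !(coefD, coefMX, coefC, coefCM) /= ?(addr0, add0r) /a /b /c.
by field.
Qed.

Let w0 := k ^+ 2 * (2 * t0 - t1 - t2) * e0.
Let w1 := k ^+ 2 * (2 * t1 - t0 - t2) * e1.
Let w2 := k ^+ 2 * (2 * t2 - t0 - t1) * e2.

Let Q_at t : root (phi f g) t -> (Qpoly f g).[t] =
  2^-1 * (k * ((6 * k * t + 2 * a) *
    (3 * k * t ^+ 2 + 2 * a * t + b) * (psi f g).[t])).
Proof.
move=> rt; have [k30 _ _ _] := Phi_split.
rewrite /Qpoly hornerZ k30; congr (_ * _).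
set p := k *: _.
have -> : (p %% phi f g).[t] = p.[t].
  by rewrite [in RHS](divp_eq p (phi f g)) hornerD hornerM (eqP rt) mulr0 add0r.
by rewrite /p ddphiE dphiE !hornerE.
Qed.

Let root_phi i : i \in [:: t0; t1; t2] -> root (phi f g) i.
Proof.
rewrite !inE => it; rewrite /root phi_split !(hornerZ, hornerM, hornerXsubC).
by case/or3P: it => /eqP ->; rewrite subrr !(mulr0, mul0r).
Qed.

Let Q_horner t : (Qpoly f g).[t] = q2 f g * t ^+ 2 + q1 f g * t + q0 f g.
Proof.
have sQ : (size (Qpoly f g) <= 3)%N.
  apply: leq_trans (size_scale_leq _ _) _; rewrite -ltnS -size_phi ltn_modp.
  by rewrite -size_poly_eq0 size_phi.
rewrite (horner_coef_wide _ sQ) !big_ord_recl big_ord0 /= /q2 /q1 /q0 /bump /=.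
ring.
Qed.

Lemma Q_split :
  [/\ q2 f g = k * (w0 + w1 + w2),
      q1 f g = - k * (w0 * (t1 + t2) + w1 * (t0 + t2) + w2 * (t0 + t1)) &
      q0 f g = k * (w0 * (t1 * t2) + w1 * (t0 * t2) + w2 * (t0 * t1))].
Proof.
have E t : t \in [:: t0; t1; t2] -> q2 f g * t ^+ 2 + q1 f g * t + q0 f g =
  2^-1 * (k * ((6 * k * t + 2 * a) *
    (3 * k * t ^+ 2 + 2 * a * t + b) * (psi f g).[t])).
  by move=> tt; rewrite -Q_horner Q_at // root_phi.
have := E t0; rewrite psi0 !inE eqxx => /(_ isT) E0.
have := E t1; rewrite psi1 !inE eqxx orbT => /(_ isT) E1.
have := E t2; rewrite psi2 !inE eqxx !orbT => /(_ isT) E2 {E}.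
(* a quadratic polynomial b2 t^2 + b1 t + b0 with three roots vanishes *)
set b2 := q2 f g - k * (w0 + w1 + w2).
set b1 := q1 f g + k * (w0 * (t1 + t2) + w1 * (t0 + t2) + w2 * (t0 + t1)).
set b0 := q0 f g - k * (w0 * (t1 * t2) + w1 * (t0 * t2) + w2 * (t0 * t1)).
have F0 : b2 * t0 ^+ 2 + b1 * t0 + b0 = 0.
  rewrite [LHS](_ : _ = q2 f g * t0 ^+ 2 + q1 f g * t0 + q0 f g -
    k * w0 * (t0 - t1) * (t0 - t2)); last by rewrite /b2 /b1 /b0; ring.
  by rewrite E0 /w0 /a /b; field.
have F1 : b2 * t1 ^+ 2 + b1 * t1 + b0 = 0.
  rewrite [LHS](_ : _ = q2 f g * t1 ^+ 2 + q1 f g * t1 + q0 f g -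
    k * w1 * (t1 - t0) * (t1 - t2)); last by rewrite /b2 /b1 /b0; ring.
  by rewrite E1 /w1 /a /b; field.
have F2 : b2 * t2 ^+ 2 + b1 * t2 + b0 = 0.
  rewrite [LHS](_ : _ = q2 f g * t2 ^+ 2 + q1 f g * t2 + q0 f g -
    k * w2 * (t2 - t0) * (t2 - t1)); last by rewrite /b2 /b1 /b0; ring.
  by rewrite E2 /w2 /a /b; field.
have d01 : t0 - t1 != 0 by rewrite subr_eq0.
have d02 : t0 - t2 != 0 by rewrite subr_eq0.
have d12 : t1 - t2 != 0 by rewrite subr_eq0.
have G1 : b2 * (t0 + t1) + b1 = 0.
  by apply: (mulfI d01); rewrite mulr0 -[RHS](subrr 0) -{1}F0 -F1; ring.
have G2 : b2 * (t0 + t2) + b1 = 0.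
  by apply: (mulfI d02); rewrite mulr0 -[RHS](subrr 0) -{1}F0 -F2; ring.
have b2_0 : b2 = 0.
  by apply: (mulfI d12); rewrite mulr0 -[RHS](subrr 0) -{1}G1 -G2; ring.
have b1_0 : b1 = 0 by rewrite -G1 b2_0 mul0r add0r.
have b0_0 : b0 = 0 by rewrite -F0 b2_0 b1_0 !mul0r !add0r.
split; apply/eqP; rewrite -subr_eq0; apply/eqP.
- exact: b2_0.
- by rewrite -b1_0 /b1; ring.
- exact: b0_0.
Qed.

Lemma B1_split : B1 f g = k ^+ 3 * (w0 * w1 * (t0 - t1) ^+ 2 +
  w0 * w2 * (t0 - t2) ^+ 2 + w1 * w2 * (t1 - t2) ^+ 2).
Proof.
have [k30 k21 k12 _] := Phi_split.
rewrite /B1 det3E !mxE /= k30 k21 k12; have [-> -> ->] := Q_split.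
by rewrite /a /b; ring.
Qed.
End InvariantsFromRoots.

(** * Signs of the invariants *)

(** The form \sum_i w_i (x + r_i y)^2 is evaluated at (- r0, 1), which kills its
    first term, and multiplied by its coefficient of x^2; completing the square
    makes its determinant appear. *)
Lemma hankel_sign (R : realFieldType) (w0 w1 w2 r0 r1 r2 : R) :
  (w0 + w1 + w2) * (w1 * (r1 - r0) ^+ 2 + w2 * (r2 - r0) ^+ 2) =
  w0 * w1 * (r0 - r1) ^+ 2 + w0 * w2 * (r0 - r2) ^+ 2 + w1 * w2 * (r1 - r2) ^+ 2
  + (w1 * (r1 - r0) + w2 * (r2 - r0)) ^+ 2.
Proof. ring. Qed.

(** S is the coefficient of x^2 and H the determinant of the quadratic form
    \sum_i w_i (x + r_i y)^2.  If the three weights have the same sign, the form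
    is definite.  Otherwise w1 and w2, which have the same sign, prevent the
    form from being definite of the opposite sign, by [hankel_sign]. *)
Lemma signature_criterion (R : realFieldType) (P : bool) (w0 w1 w2 r0 r1 r2 : R) :
    r0 != r1 -> r0 != r2 -> r1 != r2 ->
    (P -> 0 < w1 /\ 0 < w2) -> (~~ P -> w1 < 0 /\ w2 < 0) ->
  let S := w0 + w1 + w2 in
  let H := w0 * w1 * (r0 - r1) ^+ 2 + w0 * w2 * (r0 - r2) ^+ 2
           + w1 * w2 * (r1 - r2) ^+ 2 in
  [/\ 0 < w0 -> (P <-> 0 < H /\ 0 < S),
      w0 < 0 -> (P <-> H <= 0 \/ 0 <= S) &
      w0 = 0 -> (P <-> 0 < S)].
Proof.
move=> r01 r02 r12 wP wN S H.
have sq_gt0 (x y : R) : x != y -> 0 < (x - y) ^+ 2.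
  by move=> xy; rewrite exprn_even_gt0 //= subr_eq0.
have h01 := sq_gt0 _ _ r01; have h02 := sq_gt0 _ _ r02; have h12 := sq_gt0 _ _ r12.
have h10 : 0 < (r1 - r0) ^+ 2 by apply: sq_gt0; rewrite eq_sym.
have h20 : 0 < (r2 - r0) ^+ 2 by apply: sq_gt0; rewrite eq_sym.
have H_gt0 : 0 < w0 * w1 -> 0 < w0 * w2 -> 0 < w1 * w2 -> 0 < H.
  move=> w01 w02 w12; have a01 := mulr_gt0 w01 h01.
  by have a02 := mulr_gt0 w02 h02; have a12 := mulr_gt0 w12 h12; rewrite /H; lra.
have HS := hankel_sign w0 w1 w2 r0 r1 r2.
rewrite -/S -/H in HS.
have {HS} HS : 0 < H -> 0 < S * (w1 * (r1 - r0) ^+ 2 + w2 * (r2 - r0) ^+ 2).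
  by move=> H0; rewrite HS ltr_pwDl // sqr_ge0.
case: P wP wN => [/(_ isT) [w1p w2p] _|_ /(_ isT) [w1n w2n]].
  have HS1 : 0 < H -> 0 < S.
    by move=> /HS; rewrite pmulr_lgt0 // addr_gt0 // mulr_gt0.
  split=> w0s; split=> // _.
  - have w01 := mulr_gt0 w0s w1p; have w02 := mulr_gt0 w0s w2p.
    have w12 := mulr_gt0 w1p w2p.
    by split; [exact: H_gt0|rewrite /S; lra].
  - by have [/HS1/ltW|] := ltP 0 H; [right|left].
  - by rewrite /S w0s add0r addr_gt0.
have HS1 : 0 < H -> S < 0.
  have N1 : w1 * (r1 - r0) ^+ 2 < 0 by rewrite nmulr_rlt0.
  have N2 : w2 * (r2 - r0) ^+ 2 < 0 by rewrite nmulr_rlt0.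
  by move=> /HS; rewrite nmulr_lgt0 //; lra.
split=> w0s; split=> //.
- by move=> [/HS1 S0 /(lt_trans S0)]; rewrite ltxx.
- have w01 : 0 < w0 * w1 by rewrite nmulr_rgt0.
  have w02 : 0 < w0 * w2 by rewrite nmulr_rgt0.
  have w12 : 0 < w1 * w2 by rewrite nmulr_rgt0.
  have H0 := H_gt0 w01 w02 w12.
  move=> [|]; first by rewrite leNgt H0.
  by rewrite leNgt HS1.
- by rewrite /S w0s add0r; lra.
Qed.

Section Criterion.
Local Notation o2 := (ord_max : 'I_3).

(** The roots of phi are the products of kap = - m / l by r0 = (1 + t) / (1 + s),
    1 and r2 = (1 - t) / (1 - s); r0 lies between 1 and r2, and r2 - 1 has the
    sign of t - s.  The number dev_i is three times the deviation of r_i from the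
    mean of the three; in particular dev1 and dev2 have opposite signs, those of
    s - t and t - s.  Up to positive factors, Phi03 q2 is - S, Phi30 B1 is H and
    Phi03 R is - dev0, for weights w0, w1 and w2 with the signs of dev0, t - s
    and t - s. *)
Lemma invariants_criterion (R : realType) (U f g : 'M[R]_3) (l m s t : R) :
    U \in unitmx -> l != 0 -> m != 0 -> 1 < s -> 1 < t -> s != t ->
    f = l *: (U^T *m diag3 (1 + s) 1 (1 - s) *m U) ->
    g = m *: (U^T *m diag3 (1 + t) 1 (1 - t) *m U) ->
  [/\ Phi03 f g * Rinv f g < 0 ->
       (s < t <-> 0 < Phi30 f g * B1 f g /\ Phi03 f g * q2 f g < 0),
      0 < Phi03 f g * Rinv f g ->
       (s < t <-> Phi30 f g * B1 f g <= 0 \/ Phi03 f g * q2 f g <= 0) &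
      Rinv f g = 0 -> (s < t <-> Phi03 f g * q2 f g < 0)].
Proof.
move=> Uu l0 m0 s1 t1 st fE gE.
have dU : \det U != 0 by rewrite -unitfE -unitmxE.
have [] := cross_sq_gt0 dU; have phE := phiE fE gE; have psE := psiE fE gE.
move: psE; move: (cross_sq U 1 o2) (cross_sq U 0 o2) (cross_sq U 0 1).
move=> c0 c1 c2 psE c0p c1p c2p.
have sp0 : 1 + s != 0 by rewrite gt_eqF //; lra.
have sm0 : 1 - s != 0 by rewrite lt_eqF //; lra.
have ms0 : s - 1 != 0 by rewrite gt_eqF //; lra.
pose p := (1 + s)^-1; pose q := (s - 1)^-1; pose dl := t - s.
have pp : 0 < p by rewrite invr_gt0; lra.
have qp : 0 < q by rewrite invr_gt0; lra.
have dl0 : dl != 0 by rewrite subr_eq0 eq_sym.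
pose r0 := (1 + t) / (1 + s); pose r2 := (1 - t) / (1 - s).
have r0p : 0 < r0 by rewrite divr_gt0; lra.
have r2p : 0 < r2 by rewrite /r2 -mulrNN -invrN !opprB divr_gt0; lra.
have r0E : r0 - 1 = dl * p by rewrite /r0 /dl /p; field.
have r2E : r2 - 1 = dl * q by rewrite /r2 /dl /q; field; rewrite sm0 ms0.
have r20E : r2 - r0 = 2 * dl * p * q.
  by rewrite /r2 /r0 /dl /p /q; field; rewrite sm0 sp0 ms0.
pose kap := - m / l.
have kap0 : kap != 0 by rewrite mulf_neq0 ?oppr_eq0 ?invr_eq0.
pose k := \det U ^+ 2 * (l ^+ 3 * ((1 + s) * (1 - s))).
have k0 : k != 0 by rewrite !mulf_neq0 ?expf_neq0.
have phi_split : phi f g =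
    k *: (('X - (kap * r0)%:P) * ('X - (kap * 1)%:P) * ('X - (kap * r2)%:P)).
  have DE x y : x != 0 -> (l * x)%:P * 'X + (m * y)%:P =
      (l * x) *: ('X - (kap * (y / x))%:P) :> {poly R}.
    move=> x0; rewrite scalerBr -!mul_polyC -polyCM -polyCN; congr (_ + _%:P).
    by rewrite /kap; field; rewrite l0 x0.
  rewrite phE !DE ?oner_neq0 // divr1 -/r0 -/r2 mul_polyC.
  move: ('X - (kap * r0)%:P) ('X - (kap * 1)%:P) ('X - (kap * r2)%:P) => A B C.
  by rewrite -!scalerAr -!scalerAl !scalerA; congr (_ *: _); rewrite /k; ring.
have e0E : (psi f g).[kap * r0] =
    c0 * (l * (kap * r0 - kap * 1) * (l * (1 - s) * (kap * r0 - kap * r2))).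
  rewrite psE !(hornerD, hornerM, hornerC, hornerX) /kap /r0 /r2; field.
  by rewrite l0 sp0 sm0.
have e1E : (psi f g).[kap * 1] =
    c1 * (l * (1 + s) * (kap * 1 - kap * r0) * (l * (1 - s) * (kap * 1 - kap * r2))).
  rewrite psE !(hornerD, hornerM, hornerC, hornerX) /kap /r0 /r2; field.
  by rewrite l0 sp0 sm0.
have e2E : (psi f g).[kap * r2] =
    c2 * (l * (1 + s) * (kap * r2 - kap * r0) * (l * (kap * r2 - kap * 1))).
  rewrite psE !(hornerD, hornerM, hornerC, hornerX) /kap /r0 /r2; field.
  by rewrite l0 sp0 sm0.
have r01 : r0 != 1 by rewrite -subr_eq0 r0E mulf_neq0 // gt_eqF.
have r12 : 1 != r2 by rewrite eq_sym -subr_eq0 r2E mulf_neq0 // gt_eqF.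
have r02 : r0 != r2.
  by rewrite eq_sym -subr_eq0 r20E !mulf_neq0 ?pnatr_eq0 // gt_eqF.
have T01 : kap * r0 != kap * 1 by rewrite (inj_eq (mulfI kap0)).
have T02 : kap * r0 != kap * r2 by rewrite (inj_eq (mulfI kap0)).
have T12 : kap * 1 != kap * r2 by rewrite (inj_eq (mulfI kap0)).
have [k30 _ _ k03] := Phi_split phi_split.
have RE := Rinv_split k0 phi_split.
have [q2E _ _] := Q_split k0 T01 T02 T12 phi_split e0E e1E e2E.
have B1E := B1_split k0 T01 T02 T12 phi_split e0E e1E e2E.
pose dev0 := 2 * r0 - 1 - r2; pose dev1 := 2 * 1 - r0 - r2.
pose dev2 := 2 * r2 - r0 - 1.
pose w0 := dev0 * c0 * (1 - s) * (r0 - 1) * (r0 - r2).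
pose w1 := dev1 * c1 * (1 + s) * (1 - s) * (1 - r0) * (1 - r2).
pose w2 := dev2 * c2 * (1 + s) * (r2 - r0) * (r2 - 1).
have q2W : Phi03 f g * q2 f g =
    - (k ^+ 4 * l ^+ 2 * kap ^+ 6 * (r0 * r2)) * (w0 + w1 + w2).
  by rewrite k03 q2E /w0 /w1 /w2 /dev0 /dev1 /dev2; ring.
have B1W : Phi30 f g * B1 f g = (k ^+ 8 * l ^+ 4 * kap ^+ 8) *
  (w0 * w1 * (r0 - 1) ^+ 2 + w0 * w2 * (r0 - r2) ^+ 2 + w1 * w2 * (1 - r2) ^+ 2).
  rewrite k30 B1E /w0 /w1 /w2 -/dev0 -/dev1 -/dev2.
  rewrite (_ : 2 * (kap * r0) - kap * 1 - kap * r2 = kap * dev0);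
    last by rewrite /dev0; ring.
  rewrite (_ : 2 * (kap * 1) - kap * r0 - kap * r2 = kap * dev1);
    last by rewrite /dev1; ring.
  rewrite (_ : 2 * (kap * r2) - kap * r0 - kap * 1 = kap * dev2);
    last by rewrite /dev2; ring.
  ring.
have RW : Phi03 f g * Rinv f g =
    k ^+ 4 * kap ^+ 6 * (r0 * r2) * (dev0 * dev1 * dev2).
  by rewrite k03 RE /dev0 /dev1 /dev2; ring.
have dev1E : dev1 = - dl * (p + q).
  by transitivity (- (r0 - 1) - (r2 - 1)); [rewrite /dev1|rewrite r0E r2E]; ring.
have dev2E : dev2 = dl * (q + 2 * p * q).
  by transitivity ((r2 - r0) + (r2 - 1)); [rewrite /dev2|rewrite r20E r2E]; ring.
have w0E : w0 = c0 * (s - 1) * (2 * dl ^+ 2 * p ^+ 2 * q) * dev0.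
  by rewrite /w0 r0E -(opprB r2 r0) r20E; ring.
have w1E : w1 = dl * ((p + q) * c1 * (1 + s) * (s - 1) * (dl ^+ 2 * p * q)).
  by rewrite /w1 -(opprB r0 1) -(opprB r2 1) r0E r2E dev1E; ring.
have w2E : w2 = dl * ((q + 2 * p * q) * c2 * (1 + s) * (2 * dl ^+ 2 * p * q ^+ 2)).
  by rewrite /w2 r20E r2E dev2E; ring.
have dl2 : 0 < dl ^+ 2 by rewrite exprn_even_gt0.
have sp : 0 < 1 + s by lra.
have ms : 0 < s - 1 by lra.
have pq : 0 < p + q by rewrite addr_gt0.
have q2pq : 0 < q + 2 * p * q by rewrite addr_gt0 ?mulr_gt0.
have w0_pos : 0 < c0 * (s - 1) * (2 * dl ^+ 2 * p ^+ 2 * q).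
  by move: (dl ^+ 2) dl2 => ? ?; rewrite !mulr_gt0.
have w1_pos : 0 < (p + q) * c1 * (1 + s) * (s - 1) * (dl ^+ 2 * p * q).
  by move: (dl ^+ 2) dl2 => ? ?; rewrite !mulr_gt0.
have w2_pos : 0 < (q + 2 * p * q) * c2 * (1 + s) * (2 * dl ^+ 2 * p * q ^+ 2).
  by move: (dl ^+ 2) dl2 => ? ?; rewrite !mulr_gt0.
have even_pow_gt0 (x : R) n : x != 0 -> 0 < x ^+ (2 * n).
  by move=> x0; rewrite exprM exprn_gt0 // exprn_even_gt0.
have k4 : 0 < k ^+ 4 := even_pow_gt0 k 2%N k0.
have k8 : 0 < k ^+ 8 := even_pow_gt0 k 4%N k0.
have kap6 : 0 < kap ^+ 6 := even_pow_gt0 kap 3%N kap0.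
have kap8 : 0 < kap ^+ 8 := even_pow_gt0 kap 4%N kap0.
have l2 : 0 < l ^+ 2 := even_pow_gt0 l 1%N l0.
have l4 : 0 < l ^+ 4 := even_pow_gt0 l 2%N l0.
have r02p : 0 < r0 * r2 by rewrite mulr_gt0.
have K1 : 0 < k ^+ 4 * l ^+ 2 * kap ^+ 6 * (r0 * r2).
  exact: mulr_gt0 (mulr_gt0 (mulr_gt0 k4 l2) kap6) r02p.
have K2 : 0 < k ^+ 8 * l ^+ 4 * kap ^+ 8.
  exact: mulr_gt0 (mulr_gt0 k8 l4) kap8.
have K3 : 0 < k ^+ 4 * kap ^+ 6 * (r0 * r2) * (dl ^+ 2 * (p + q) * (q + 2 * p * q)).
  apply: mulr_gt0 (mulr_gt0 (mulr_gt0 k4 kap6) r02p) _.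
  exact: mulr_gt0 (mulr_gt0 dl2 pq) q2pq.
have RW2 : Phi03 f g * Rinv f g = - (k ^+ 4 * kap ^+ 6 * (r0 * r2) *
    (dl ^+ 2 * (p + q) * (q + 2 * p * q))) * dev0.
  by rewrite RW dev1E dev2E; ring.
have wpos : s < t -> 0 < w1 /\ 0 < w2.
  rewrite -subr_gt0 -/dl => dlp.
  by rewrite w1E w2E !(pmulr_lgt0 _ w1_pos, pmulr_lgt0 _ w2_pos).
have wneg : ~~ (s < t) -> w1 < 0 /\ w2 < 0.
  rewrite -leNgt le_eqVlt eq_sym (negPf st) /= -subr_lt0 -/dl => dln.
  by rewrite w1E w2E !(pmulr_llt0 _ w1_pos, pmulr_llt0 _ w2_pos).
have [C1 C2 C3] := signature_criterion w0 r01 r02 r12 wpos wneg.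
have S_lt0 : (Phi03 f g * q2 f g < 0) = (0 < w0 + w1 + w2).
  by rewrite q2W mulNr oppr_lt0 pmulr_rgt0.
have S_le0 : (Phi03 f g * q2 f g <= 0) = (0 <= w0 + w1 + w2).
  by rewrite q2W mulNr oppr_le0 pmulr_rge0.
split.
- rewrite RW2 mulNr oppr_lt0 pmulr_rgt0 // => dev0p.
  rewrite S_lt0 B1W (pmulr_rgt0 _ K2); apply: C1.
  by rewrite w0E pmulr_rgt0.
- rewrite RW2 mulNr oppr_gt0 pmulr_rlt0 // => dev0n.
  rewrite S_le0 B1W (pmulr_rle0 _ K2); apply: C2.
  by rewrite w0E pmulr_rlt0.
- move=> R0; rewrite S_lt0; apply: C3.
  move: RW2; rewrite R0 mulr0 => /esym/eqP; rewrite mulf_eq0 oppr_eq0 (gt_eqF K3) /=.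
  by rewrite w0E => /eqP ->; rewrite mulr0.
Qed.
End Criterion.

Theorem proposition10 (R : realType) (f g : 'M[R]_3)
    (f_sym : f^T = f) (g_sym : g^T = g)
    (f_nondeg : \det f != 0) (g_nondeg : \det g != 0)
    (fg_Ia : orbit_Ia f g) (fg_IaN : class_IaN f g) :
  (Phi03 f g * Rinv f g < 0 ->
     (lies_inside f g <->
      0 < Phi30 f g * B1 f g /\ Phi03 f g * q2 f g < 0)) /\
  (0 < Phi03 f g * Rinv f g ->
     (lies_inside f g <->
      Phi30 f g * B1 f g <= 0 \/ Phi03 f g * q2 f g <= 0)) /\
  (Rinv f g = 0 ->
     (lies_inside f g <-> Phi03 f g * q2 f g < 0)).
Proof.
have [U [l [m [s [t [[Uu l0 m0 s1 t1] [st fE gE]]]]]]] :=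
  IaN_normal_form f_nondeg g_nondeg fg_IaN.
have [_ [_ f0] _ _ _] := fg_IaN.
have ins := lies_inside_diag3 Uu l0 m0 s1 t1 f0 fE gE.
have [C1 C2 C3] := invariants_criterion Uu l0 m0 s1 t1 st fE gE.
split=> [H|]; first exact: iff_trans ins (C1 H).
by split=> H; [exact: iff_trans ins (C2 H)|exact: iff_trans ins (C3 H)].
Qed.
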